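(* Let $0<\delta<1/8$, $0<\rho<1$, and let $n\geq1$ be sufficiently large. Let $V_1,V_2,V_3$ be disjoint sets of size $n$, let $G$ be a tripartite graph with parts $V_1,V_2,V_3$, and let $K_3(G)$ denote the set of $(x,y,z)\in V_1\times V_2\times V_3$ with $xy,xz,yz$ all edges of $G$. Let $H=(V_1\cup V_2\cup V_3,F)$ be the tripartite $3$-graph with $F=\{xyz:(x,y,z)\in K_3(G)\}$, and suppose $|K_3(G)|=\rho|V_1||V_2||V_3|$. Let $\mathcal{V}_0$ be a partition of $V(H)$ refining $\{V_1,V_2,V_3\}$ with at most $3^{200}$ parts. Then there is a decomposition $\mathcal{P}=(\mathcal{P}_1,\mathcal{P}_2)$ of $V(H)$ with $\mathcal{P}_1$ refining $\mathcal{V}_0$ which is $\langle\delta\rangle$-regular for $H$ and satisfies $|\mathcal{P}_1|\leq 3^{200}\,T_3(\delta^{-1000}\rho^{-1000})$.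
   Context: For $m>0$, $T_m(1)=m$ and $T_m(x+1)=T_m(x)2^{T_m(x)}$; for real $y>0$, $T_3(y)$ means $T_3(\lceil y\rceil)$. A bigraph is $B=(U,W;E)$ with $E\subseteq U\times W$; $d_B(U',W')=|E\cap(U'\times W')|/(|U'||W'|)$. $B$ is $\langle\delta\rangle$-regular if $d_B(U',W')\geq d_B(U,W)/2$ for all $U'\subseteq U$, $W'\subseteq W$ with $|U'|\geq\delta|U|$, $|W'|\geq\delta|W|$. For a graph $\Gamma=(V,E)$, a partition $\mathcal{Q}$ of $V$ is $\langle\delta\rangle$-regular for $\Gamma$ if there is a graph $\Gamma'=(V,E')$ with $|E\,\triangle\,E'|\leq\delta|E|$ such that for all distinct $A,B\in\mathcal{Q}$ the bigraph $(A,B;\{(a,b)\in A\times B: ab\in E'\})$ is $\langle\delta\rangle$-regular. A decomposition $\mathcal{P}$ of a set $V$ consists of a partition $\mathcal{P}_1$ of $V$ and, for each $X,Y\in\mathcal{P}_1$, a partition of $X\times Y$; $\mathcal{P}_2$ is the set of all parts of these partitions. $\mathcal{P}$ is $\langle\delta\rangle$-good if for every $P\in\mathcal{P}_2$ with $P\subseteq X\times Y$ ($X,Y\in\mathcal{P}_1$) the bigraph $(X,Y;P)$ is $\langle\delta\rangle$-regular. For the tripartite $3$-graph $H$ and $\{i_1,i_2,i_3\}=\{1,2,3\}$ with $i_2<i_3$, let $G^{i_1}_H$ be the bipartite graph with parts $V_{i_1}$ and $V_{i_2}\times V_{i_3}$ in which $u\in V_{i_1}$ is adjacent to $(v,w)$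 iff $\{u,v,w\}\in F$. If $\mathcal{P}_1$ refines $\{V_1,V_2,V_3\}$, $\mathcal{P}$ induces the partition $\mathcal{P}^{i_1}_1$ of $V_{i_1}\cup(V_{i_2}\times V_{i_3})$ consisting of the parts of $\mathcal{P}_1$ contained in $V_{i_1}$ together with all $P\in\mathcal{P}_2$ with $P\subseteq X\times Y$ for some $X,Y\in\mathcal{P}_1$ with $X\subseteq V_{i_2}$, $Y\subseteq V_{i_3}$. $\mathcal{P}$ (with $\mathcal{P}_1$ refining $\{V_1,V_2,V_3\}$) is $\langle\delta\rangle$-regular for $H$ if it is $\langle\delta\rangle$-good and for each $i_1\in\{1,2,3\}$, $\mathcal{P}^{i_1}_1$ is a $\langle\delta\rangle$-regular partition of $G^{i_1}_H$. *)

(* Defs.v *)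
From HB Require Import structures.
From mathcomp Require Import all_boot all_order all_algebra.
From mathcomp Require Import reals.

Set Implicit Arguments.
Unset Strict Implicit.
Unset Printing Implicit Defensive.

Import Order.TTheory GRing.Theory Num.Theory.
Local Open Scope ring_scope.

(* T_m(1) = m and T_m(x+1) = T_m(x) 2^{T_m(x)}; the value at x = 0 is junk. *)
Definition tower (m x : nat) : nat := iter x.-1 (fun t => t * 2 ^ t)%N m.

(* Only meant for y > 0, where the ceiling is a positive integer. *)
Definition tower_real (R : realType) (m : nat) (y : R) : nat :=
  tower m `|Num.ceil y|%N.

Section Bigraph.
Variables (R : realType) (S1 S2 : finType).
Implicit Types (U : {set S1}) (W : {set S2}) (E : {set S1 * S2}).

Definition density E U W : R :=
  #|E :&: setX U W|%:R / (#|U|%:R * #|W|%:R).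

Definition regular_bigraph (delta : R) U W E : Prop :=
  forall U' W', U' \subset U -> W' \subset W ->
    delta * #|U|%:R <= #|U'|%:R -> delta * #|W|%:R <= #|W'|%:R ->
    density E U W / 2 <= density E U' W'.

End Bigraph.

Record graph (S : finType) := Graph {
  vertices : {set S};
  edges : {set {set S}};
  graphP : forall e, e \in edges -> e \subset vertices /\ #|e| = 2 }.

Definition adj (S : finType) (G : graph S) (x y : S) : bool :=
  [set x; y] \in edges G.

Definition between (S : finType) (G : graph S) (A B : {set S}) : {set S * S} :=
  [set p in setX A B | adj G p.1 p.2].

Definition regular_partition (R : realType) (S : finType) (delta : R)
    (G : graph S) (Q : {set {set S}}) : Prop :=
  partition Q (vertices G) /\
  exists G' : graph S,
    [/\ vertices G' = vertices G,
        #|(edges G :\: edges G') :|: (edges G' :\: edges G)|%:R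
          <= delta * #|edges G|%:R
      & forall A B, A \in Q -> B \in Q -> A != B ->
          regular_bigraph delta A B (between G' A B)].

Definition refines (S : finType) (P Q : {set {set S}}) : Prop :=
  forall A, A \in P -> exists2 B, B \in Q & A \subset B.

(* [cell D X Y] is only meaningful for X, Y in [part1 D]. *)
Record decomposition (T : finType) (V : {set T}) := Decomposition {
  part1 : {set {set T}};
  cell : {set T} -> {set T} -> {set {set T * T}};
  part1P : partition part1 V;
  cellP : forall X Y, X \in part1 -> Y \in part1 ->
    partition (cell X Y) (setX X Y) }.

Definition part2 (T : finType) (V : {set T}) (D : decomposition V) :
    {set {set T * T}} :=
  \bigcup_(X in part1 D) \bigcup_(Y in part1 D) cell D X Y.

Definition good (R : realType) (T : finType) (V : {set T}) (delta : R)
    (D : decomposition V) : Prop :=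
  forall P X Y, P \in part2 D -> X \in part1 D -> Y \in part1 D ->
    P \subset setX X Y -> regular_bigraph delta X Y P.

Section Tripartite.
Variables (T : finType) (V : 'I_3 -> {set T}).

Definition classes3 : {set {set T}} := [set V i | i : 'I_3].

Definition vertex_union : {set T} := \bigcup_(i : 'I_3) V i.

Definition tripartite (G : graph T) : Prop :=
  vertices G = vertex_union /\
  forall i x y, x \in V i -> y \in V i -> ~~ adj G x y.

(* Indices 0, 1, 2 of 'I_3 stand for 1, 2, 3. *)
Definition K3 (G : graph T) : {set T * T * T} :=
  [set t : T * T * T |
    [&& t.1.1 \in V (inord 0), t.1.2 \in V (inord 1), t.2 \in V (inord 2),
        adj G t.1.1 t.1.2, adj G t.1.1 t.2 & adj G t.1.2 t.2]].

Definition triangle_edges (G : graph T) : {set {set T}} :=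
  [set [set t.1.1; t.1.2; t.2] | t in K3 G].

(* The disjoint union of V_{i1} and V_{i2} x V_{i3} lives in T + T * T. *)
Section Link.
Variables (F : {set {set T}}) (i1 i2 i3 : 'I_3).

Definition link_vertices : {set T + T * T} :=
  [set inl u | u in V i1] :|: [set inr p | p in setX (V i2) (V i3)].

Definition link_edges : {set {set T + T * T}} :=
  [set [set inl q.1; inr q.2] | q in
    [set q in setX (V i1) (setX (V i2) (V i3)) |
      [set q.1; q.2.1; q.2.2] \in F]].

Lemma link_graphP e :
  e \in link_edges -> e \subset link_vertices /\ #|e| = 2.
Proof.
case/imsetP=> -[u p]; rewrite !inE /= => /andP[/andP[uV pV] _] ->.
split; last by rewrite cards2.
apply/subsetP=> x /set2P[] ->; rewrite inE.
- by apply/orP; left; apply/imset_f.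
- by apply/orP; right; apply/imset_f; rewrite inE.
Qed.

Definition link_graph : graph (T + T * T)%type := Graph link_graphP.

Definition link_partition (D : decomposition vertex_union) :
    {set {set T + T * T}} :=
  [set [set inl u | u in X] | X : {set T} in part1 D & X \subset V i1] :|:
  [set [set inr p | p in P] | P : {set T * T} in part2 D &
    [exists X in part1 D, exists Y in part1 D,
      [&& P \subset setX X Y, X \subset V i2 & Y \subset V i3]]].

End Link.

Definition regular_decomposition (R : realType) (delta : R) (F : {set {set T}})
    (D : decomposition vertex_union) : Prop :=
  [/\ refines (part1 D) classes3,
      good delta D
    & forall i1 i2 i3 : 'I_3,
        [set i1; i2; i3] = [set: 'I_3] -> (i2 < i3)%N ->
        regular_partition delta (link_graph F i1 i2 i3)
          (link_partition i1 i2 i3 D)].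

End Tripartite.

(* Main.v *)
Require Import Defs.
From HB Require Import structures.
From mathcomp Require Import all_boot all_order all_algebra.
From mathcomp Require Import reals.
From mathcomp Require Import ring lra.

(** Szemeredi's energy increment gives a partition of the vertices, refining
    V0, in which all but few pairs (X, Y) satisfy the discrepancy bound
    |e(A, B) - d |A| |B|| <= eps |X| |Y| for all A, B.  Let b agree with G,
    except that irregular and sparse pairs are emptied and very dense pairs are
    filled.  Every X * Y is then split into b-edges and b-non-edges; both are
    regular because each density is 0, 1 or bounded away from both.  The
    triangles of b approximate those of G, and a set Q of b-edges in Y * Z sees
    the expected number of common neighbours in A by slicing Q twice, so no
    regularity of Q is needed.  Partitions are represented by colourings, and
    splitting by all witnesses maps k colours to k * 4^k, two tower steps. *)

Set Implicit Arguments.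
Unset Strict Implicit.
Unset Printing Implicit Defensive.

Import Order.TTheory GRing.Theory Num.Theory.
Local Open Scope ring_scope.

(** Goodness allows no exceptional cell, while a link partition may ignore a change of delta |E|
    edges. So bad pairs cannot be discarded and are repaired in [b]; the graph permitted to differ
    from the link of G is the link of the b-triangles. Regularity of a bigraph is one-sided and
    relative to its density, so an additive error eps is harmless if the density is 0 or at least
    eta. The b-non-edges form cells too, so the same is needed of the complementary density, and
    this is why very dense pairs are filled. In the link, a cell of b-non-edges meets no b-triangle
    and needs no argument. The constants come from counting. At most eta n^2 + eta (3n)^2 = 10 eta
    n^2 pairs change, each affects at most n triples in each of three positions, and 30 eta n^3 <=
    delta rho n^3 = delta |K_3(G)|. The energy is at most (3n)^2 and a round gains eps^2 eta n^2, so
    the number of rounds is polynomial in 1/(delta rho), and so is the height of the tower. *)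

Definition refines_col (T C D : Type) (c : T -> C) (d : T -> D) : Prop :=
  forall x y, c x = c y -> d x = d y.

(** * Conditional averages and energy *)

Section Averaging.
Variables (R : realFieldType) (U : finType).
Implicit Types (w g : U -> R).

(** Conditional expectation of [w] given [k], under counting measure; [energy] is its squared L2
    norm, left unnormalised. *)
Definition avg (K : finType) (k : U -> K) w (u : U) : R :=
  (\sum_(v | k v == k u) w v) / #|[pred v | k v == k u]|%:R.

Definition energy (K : finType) (k : U -> K) w : R :=
  \sum_u avg k w u ^+ 2.

Lemma card_fiber_gt0 (K : finType) (k : U -> K) u :
  0 < #|[pred v | k v == k u]|%:R :> R.
Proof. by rewrite ltr0n; apply/card_gt0P; exists u; rewrite inE. Qed.

Lemma avg_fiber (K : finType) (k : U -> K) w u v :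
  k u = k v -> avg k w u = avg k w v.
Proof. by move=> e; rewrite /avg e. Qed.

(** Averaging is self-adjoint and fixes functions that are constant on fibres. *)
Lemma sum_avg (K : finType) (k : U -> K) w g :
  (forall u v, k u = k v -> g u = g v) ->
  \sum_u avg k w u * g u = \sum_u w u * g u.
Proof.
move=> kg; under eq_bigr do rewrite /avg mulrAC mulr_suml mulr_suml.
rewrite (exchange_big_dep predT) //=; apply: eq_bigr => v _.
transitivity (\sum_(u | k v == k u) w v * g v / #|[pred z | k z == k v]|%:R).
  by apply: eq_bigr => u /eqP e; rewrite (kg _ _ e) e.
rewrite sumr_const -[RHS](divfK (lt0r_neq0 (card_fiber_gt0 k v))) -[LHS]mulr_natr.
by congr (_ * _%:R); apply: eq_card => u; rewrite !inE eq_sym.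
Qed.

(** Bounding by the sum of [w], not by the size of [U], matters: colourings live on all of [T], and
    pairs outside the vertex set then cost nothing. *)
Lemma energy_le (K : finType) (k : U -> K) w :
  (forall u, 0 <= w u <= 1) -> energy k w <= \sum_u w u.
Proof.
move=> w01; rewrite /energy; under eq_bigr do rewrite expr2.
rewrite sum_avg; last by move=> u v; apply: avg_fiber.
apply: ler_sum => u _; have /andP[w0 _] := w01 u.
rewrite -[leRHS]mulr1 ler_wpM2l // /avg ler_pdivrMr ?card_fiber_gt0 // mul1r.
rewrite -sum1_card natr_sum; apply: ler_sum => v _; by case/andP: (w01 v).
Qed.

Lemma avg_bounds (K : finType) (k : U -> K) w u :
  (forall u, 0 <= w u <= 1) -> 0 <= avg k w u <= 1.
Proof.
move=> w01; rewrite /avg ler_pdivrMr ?card_fiber_gt0 // mul1r.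
rewrite divr_ge0 ?ler0n ?sumr_ge0 //=; last by move=> v _; case/andP: (w01 v).
rewrite -sum1_card natr_sum; apply: ler_sum => v _; by case/andP: (w01 v).
Qed.

(** Pythagoras: the coarse average is the projection of the fine one, so their difference is
    orthogonal to it. *)
Lemma energy_refine (K K' : finType) (k : U -> K) (k' : U -> K') w :
  refines_col k' k ->
  energy k' w = energy k w + \sum_u (avg k' w u - avg k w u) ^+ 2.
Proof.
move=> kk'; rewrite /energy -big_split /=.
have e : \sum_u avg k' w u * avg k w u = \sum_u avg k w u * avg k w u.
  rewrite [LHS]sum_avg; last by move=> u v /kk'; apply: avg_fiber.
  by rewrite sum_avg // => u v; apply: avg_fiber.
apply/eqP; rewrite -subr_eq0 -sumrB.
rewrite (eq_bigr (fun u => 2 * (avg k' w u * avg k w u - avg k w u * avg k w u))).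
  by rewrite -mulr_sumr sumrB e subrr mulr0.
by move=> u _; ring.
Qed.

(* For h = avg k' w - avg k w and t = +-eps, integrate h^2 >= 2 t h - t^2 over S. *)
Lemma block_increment (K K' : finType) (k : U -> K) (k' : U -> K') w
    (eps : R) (i : K) (S : {set U}) :
  0 <= eps -> (forall u, u \in S -> k u = i) ->
  (forall u v, k' u = k' v -> u \in S -> v \in S) ->
  eps * #|[pred u | k u == i]|%:R <= `|\sum_(u in S) (w u - avg k w u)| ->
  eps ^+ 2 * #|[pred u | k u == i]|%:R
    <= \sum_(u | k u == i) (avg k' w u - avg k w u) ^+ 2.
Proof.
move=> eps0 Si Ssat; set m := #|_|%:R => big.
pose h u := avg k' w u - avg k w u.
have hS : \sum_(u in S) h u = \sum_(u in S) (w u - avg k w u).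
  rewrite !sumrB; congr (_ - _).
  have mask F : \sum_(u in S) F u = \sum_u F u * (u \in S)%:R :> R.
    by rewrite big_mkcond; apply: eq_bigr => u _; rewrite mulr_natr mulrb.
  rewrite !mask; apply: sum_avg => u v e; congr (nat_of_bool _)%:R.
  by apply/idP/idP => hu; apply: Ssat hu.
have Sm : #|S|%:R <= m.
  rewrite ler_nat; apply: subset_leq_card; apply/subsetP => u /Si.
  by rewrite inE => ->.
have main t : t ^+ 2 = eps ^+ 2 -> eps * `|\sum_(u in S) h u| = t * \sum_(u in S) h u ->
    eps ^+ 2 * m <= \sum_(u | k u == i) h u ^+ 2.
  move=> t2 th.
  apply: (@le_trans _ _ (\sum_(u in S) h u ^+ 2)); last first.
    rewrite [leRHS](bigID (mem S)) /= -[leLHS]addr0 lerD //; last first.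
      by apply: sumr_ge0 => u _; apply: sqr_ge0.
    rewrite le_eqVlt; apply/orP; left; apply/eqP; apply: eq_bigl => u.
    by case: (boolP (u \in S)) => [/Si -> | _]; rewrite ?eqxx ?andbF.
  apply: (@le_trans _ _ (\sum_(u in S) (2 * (t * h u) - eps ^+ 2))).
    rewrite sumrB -!mulr_sumr -th hS sumr_const -mulr_natr.
    have := ler_wpM2l eps0 big; have := ler_wpM2l (sqr_ge0 eps) Sm.
    by rewrite !expr2; lra.
  apply: ler_sum => u _; rewrite -t2 -subr_ge0.
  by rewrite (_ : _ - _ = (h u - t) ^+ 2) ?sqr_ge0 //; ring.
have [s0|s0] := lerP 0 (\sum_(u in S) h u).
  by apply: (main eps) => //; rewrite ger0_norm.
by apply: (main (- eps)); rewrite ?sqrrN // ltr0_norm // mulrN mulNr.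
Qed.

(** One refinement [k'] resolves the witnesses of all bad blocks at once, so the gains of
    [block_increment] add up over the blocks. *)
Lemma energy_increment (K K' : finType) (k : U -> K) (k' : U -> K') w
    (eps : R) (bad : pred K) (S : K -> {set U}) :
  0 <= eps -> refines_col k' k ->
  (forall i u, bad i -> u \in S i -> k u = i) ->
  (forall i u v, bad i -> k' u = k' v -> u \in S i -> v \in S i) ->
  (forall i, bad i -> eps * #|[pred u | k u == i]|%:R
                     <= `|\sum_(u in S i) (w u - avg k w u)|) ->
  energy k w + eps ^+ 2 * #|[pred u | bad (k u)]|%:R <= energy k' w.
Proof.
move=> eps0 ref Sk Ssat Sbig; rewrite (energy_refine w ref) lerD2l.
rewrite (partition_big k predT) //= -sum1_card natr_sum mulr_sumr.
rewrite (partition_big k bad) //= [leRHS](bigID bad) /= -[leLHS]addr0.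
apply: lerD; last by apply: sumr_ge0 => i _; apply: sumr_ge0 => u _; apply: sqr_ge0.
apply: ler_sum => i bi.
apply: le_trans (block_increment eps0 _ _ (Sbig _ bi)); last 2 first.
- by move=> u; apply: Sk.
- by move=> u v; apply: Ssat.
rewrite -mulr_sumr ler_wpM2l ?sqr_ge0 // -sum1_card natr_sum.
rewrite le_eqVlt; apply/orP; left; apply/eqP; apply: eq_bigl => u.
by rewrite !inE andbC; case: eqP => //= ->.
Qed.

End Averaging.

(** * Discrepancy regularity *)

Section Weight.
Variables (R : realFieldType) (S1 S2 : finType).
Implicit Types (w : S1 -> S2 -> R) (A X : {set S1}) (B Y : {set S2}).

Definition weight w A B : R := \sum_(x in A) \sum_(y in B) w x y.

(** The error is relative to X and Y, not to A and B, so no lower bound on A and B is needed. It is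
    a boolean so that irregular pairs can be counted. *)
Definition uniform (eps d : R) w X Y : bool :=
  [forall A : {set S1}, forall B : {set S2}, (A \subset X) ==> (B \subset Y) ==>
    (`|weight w A B - d * (#|A|%:R * #|B|%:R)| <= eps * (#|X|%:R * #|Y|%:R))].

Lemma uniformP (eps d : R) w X Y :
  reflect (forall A B, A \subset X -> B \subset Y ->
    `|weight w A B - d * (#|A|%:R * #|B|%:R)| <= eps * (#|X|%:R * #|Y|%:R))
    (uniform eps d w X Y).
Proof.
apply: (iffP forallP) => [h A B hA hB | h A].
  by have /forallP/(_ B) := h A; rewrite hA hB.
by apply/forallP => B; apply/implyP => hA; apply/implyP => hB; apply: h.
Qed.

Lemma weight_setX w A B : weight w A B = \sum_(p in setX A B) w p.1 p.2.
Proof.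
rewrite /weight pair_big /=; apply: eq_big => [[x y]|//].
by rewrite in_setX.
Qed.

End Weight.

Section Regularity.
Variables (R : realFieldType) (T : finType).
Implicit Types (w : T -> T -> R).

Definition col_class (C : finType) (c : T -> C) (i : C) : {set T} :=
  [set x | c x == i].

Definition pair_col (C : Type) (c : T -> C) (p : T * T) : C * C := (c p.1, c p.2).

Definition col_density (C : finType) (c : T -> C) w (p : T * T) : R :=
  avg (pair_col c) (fun q => w q.1 q.2) p.

(** Indexed by pairs of points rather than of classes: counting failures then weights an irregular
    pair of classes by |X||Y|. *)
Definition uniform_at (C : finType) (c : T -> C) w (eps : R) (p : T * T) : bool :=
  uniform eps (col_density c w p) w (col_class c (c p.1)) (col_class c (c p.2)).

Lemma card_pair_col (C : finType) (c : T -> C) (i : C * C) :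
  #|[pred u | pair_col c u == i]| = (#|col_class c i.1| * #|col_class c i.2|)%N.
Proof.
rewrite -cardsX; apply: eq_card => -[x y]; case: i => i j.
by rewrite !inE /pair_col xpair_eqE.
Qed.

Lemma col_density_card (C : finType) (c : T -> C) w (p : T * T) :
  weight w (col_class c (c p.1)) (col_class c (c p.2)) =
  col_density c w p *
    (#|col_class c (c p.1)|%:R * #|col_class c (c p.2)|%:R).
Proof.
rewrite -natrM -(card_pair_col c (pair_col c p)).
rewrite /col_density /avg divfK ?lt0r_neq0 ?card_fiber_gt0 // weight_setX.
by apply: eq_bigl => -[x y]; rewrite !inE /pair_col xpair_eqE.
Qed.

Definition split_count (k : nat) : nat := (k * 2 ^ k * 2 ^ k)%N.

Lemma leq_split_count k : (k <= split_count k)%N.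
Proof. by rewrite /split_count -mulnA leq_pmulr // muln_gt0 expn_gt0. Qed.

Lemma regularity_step (C : finType) (c : T -> C) w (eps : R) :
  0 <= eps ->
  exists (C' : finType) (c' : T -> C'),
    [/\ refines_col c' c, #|C'| = split_count #|C|
      & energy (pair_col c) (fun q => w q.1 q.2)
        + eps ^+ 2 * #|[pred p | ~~ uniform_at c w eps p]|%:R
        <= energy (pair_col c') (fun q => w q.1 q.2)].
Proof.
move=> eps0; pose cl := col_class c.
pose d (i : C * C) : R := weight w (cl i.1) (cl i.2) / (#|cl i.1|%:R * #|cl i.2|%:R).
have dE p : col_density c w p = d (pair_col c p).
  rewrite /d col_density_card mulfK // -natrM -(card_pair_col c (pair_col c p)).
  by rewrite lt0r_neq0 ?card_fiber_gt0.
pose wits (i : C * C) (AB : {set T} * {set T}) :=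
  [&& AB.1 \subset cl i.1, AB.2 \subset cl i.2 &
    eps * (#|cl i.1|%:R * #|cl i.2|%:R)
      < `|weight w AB.1 AB.2 - d i * (#|AB.1|%:R * #|AB.2|%:R)|].
pose wit i := odflt (set0, set0) [pick AB | wits i AB].
pose bad i := ~~ uniform eps (d i) w (cl i.1) (cl i.2).
have witP i : bad i -> wits i (wit i).
  rewrite /bad /uniform negb_forall => /existsP[A].
  rewrite negb_forall => /existsP[B]; rewrite !negb_imply -ltNge => /and3P[hA hB h].
  rewrite /wit; case: pickP => [AB //|] /(_ (A, B)).
  by rewrite /wits /= hA hB h.
(* Besides its old colour, a point records its membership in the left witnesses of all pairs
   starting at its class and in the right witnesses of all pairs ending there. Pairs without a
   witness hold the default [set0], which splits nothing. *)
pose c' x := (c x, [set j | x \in (wit (c x, j)).1], [set i | x \in (wit (i, c x)).2]).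
exists (C * {set C} * {set C})%type, c'; split.
- by move=> x y [].
- have cardS : #|{set C}| = (2 ^ #|C|)%N by rewrite -[LHS]cardsT -powersetT card_powerset cardsT.
  by rewrite !card_prod cardS.
rewrite (_ : #|_| = #|[pred p | bad (pair_col c p)]|); last first.
  by apply: eq_card => p; rewrite !inE /uniform_at dE.
apply: (@energy_increment _ _ _ _ _ _ _ _ _ (fun i => setX (wit i).1 (wit i).2)) => //.
- by move=> [x y] [x' y']; rewrite /pair_col => -[/= -> _ _ -> _ _].
- move=> [i j] [x y] /witP /and3P[/subsetP /= hA /subsetP /= hB _].
  by rewrite in_setX => /andP[/hA + /hB]; rewrite !inE /pair_col /= => /eqP-> /eqP->.
- move=> [i j] [x y] [x' y'] /witP /and3P[/subsetP /= hA /subsetP /= hB _].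
  rewrite /pair_col => -[/= ex ex1 _ ey _ ey2].
  rewrite !in_setX /= => /andP[xA yB].
  have:= hA _ xA; have:= hB _ yB; rewrite !inE => /eqP cy /eqP cx.
  move/setP/(_ j): ex1; move/setP/(_ i): ey2; rewrite !inE -ex -ey cx cy xA yB.
  by move=> <- <-.
move=> [i j] bi; have /and3P[/subsetP /= hA /subsetP /= hB h] := witP _ bi.
rewrite card_pair_col natrM; apply/ltW.
rewrite sumrB -weight_setX (eq_bigr (fun=> d (i, j))).
  by rewrite sumr_const cardsX -(mulr_natr (d (i, j))) natrM.
move=> [x y]; rewrite in_setX => /andP[/hA + /hB]; rewrite !inE => /eqP <- /eqP <-.
exact: dE.
Qed.

Lemma regularity (C : finType) (c : T -> C) w (eps mu : R) (k : nat) :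
  0 <= eps -> (forall x y, 0 <= w x y <= 1) ->
  \sum_p w p.1 p.2 < k%:R * (eps ^+ 2 * mu) ->
  exists (C' : finType) (c' : T -> C'),
    [/\ refines_col c' c, (#|C'| <= iter k split_count #|C|)%N
      & #|[pred p | ~~ uniform_at c' w eps p]|%:R <= mu].
Proof.
move=> eps0 w01 lt.
(* The invariant of the induction: k further gains would exceed the bound of [energy_le]. For k = 0
   it is contradictory. *)
have: \sum_p w p.1 p.2 <
    energy (pair_col c) (fun q => w q.1 q.2) + k%:R * (eps ^+ 2 * mu).
  by apply: lt_le_trans lt _; rewrite lerDr sumr_ge0 // => p _; apply: sqr_ge0.
elim: k C c {lt} => [|k IH] C c lt.
  have := energy_le (pair_col c) (fun p : T * T => w01 p.1 p.2).
  by rewrite leNgt -[X in _ < X]addr0 -[X in _ + X](mul0r (eps ^+ 2 * mu)) lt.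
have [small|big] := lerP #|[pred p | ~~ uniform_at c w eps p]|%:R mu.
  exists C, c; split=> //.
  elim: k.+1 => //= m Hm; exact: leq_trans Hm (leq_split_count _).
have [C1 [c1 [ref1 card1 en1]]] := regularity_step c w eps0.
have [|C2 [c2 [ref2 card2 small]]] := IH C1 c1.
  apply: lt_le_trans lt _; rewrite -natr1.
  have := ler_wpM2l (sqr_ge0 eps) (ltW big); lra.
exists C2, c2; split=> //; first by move=> x y /ref2/ref1.
by rewrite iterSr -card1.
Qed.

End Regularity.

(** * Regular bigraphs *)

Section Tame.
Variables (R : realFieldType) (S1 S2 : finType).
Implicit Types (w : S1 -> S2 -> R) (X : {set S1}) (Y : {set S2}).

(** Uniform with a density that is 0, 1 or at distance at least eta from both. The condition is
    symmetric, so it passes to the complement. *)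
Definition tame (eps eta : R) w X Y : Prop :=
  exists d : R,
    [/\ weight w X Y = d * (#|X|%:R * #|Y|%:R), uniform eps d w X Y,
        0 <= d <= 1, d = 0 \/ eta <= d & d = 1 \/ d <= 1 - eta].

Lemma weight_const (d : R) X Y :
  weight (fun _ _ => d) X Y = d * (#|X|%:R * #|Y|%:R).
Proof. by rewrite /weight !sumr_const -mulrnA -natrM mulr_natr mulnC. Qed.

Lemma weight_compl w X Y :
  weight (fun x y => 1 - w x y) X Y = #|X|%:R * #|Y|%:R - weight w X Y.
Proof.
rewrite -[X in X - _]mul1r -weight_const /weight -sumrB; apply: eq_bigr => x _.
by rewrite -sumrB.
Qed.

Lemma eq_weight w1 w2 X Y :
  (forall x y, x \in X -> y \in Y -> w1 x y = w2 x y) ->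
  weight w1 X Y = weight w2 X Y.
Proof. by move=> e; apply: eq_bigr => x hx; apply: eq_bigr => y hy; apply: e. Qed.

Lemma eq_tame eps eta w1 w2 X Y :
  (forall x y, x \in X -> y \in Y -> w1 x y = w2 x y) ->
  tame eps eta w1 X Y -> tame eps eta w2 X Y.
Proof.
move=> e [d [dE /uniformP u d01 d0 d1]]; exists d; split=> //.
  by rewrite -dE; apply/esym/eq_weight.
apply/uniformP => A B sA sB; rewrite -(@eq_weight w1); first exact: u.
by move=> x y /(subsetP sA) hx /(subsetP sB); apply: e.
Qed.

Lemma tame_compl eps eta w X Y :
  tame eps eta w X Y -> tame eps eta (fun x y => 1 - w x y) X Y.
Proof.
move=> [d [dE /uniformP u d01 d0 d1]]; exists (1 - d); split.
- by rewrite weight_compl dE; ring.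
- apply/uniformP => A B sA sB; have := u A B sA sB.
  by rewrite weight_compl -normrN; congr (`|_| <= _); ring.
- lra.
- by case: d1 => d1; [left|right]; lra.
- by case: d0 => d0; [left|right]; lra.
Qed.

Lemma tame_const eps eta (b : bool) X Y :
  0 <= eps -> eta <= 1 -> tame eps eta (fun _ _ => b%:R) X Y.
Proof.
move=> e0 h1; exists b%:R; split; rewrite ?weight_const //.
- apply/uniformP => A B _ _; rewrite weight_const subrr normr0.
  by rewrite !mulr_ge0.
- by case: b; rewrite lexx ler01.
- by case: b; [right|left].
- by case: b; [left|right; rewrite subr_ge0].
Qed.

End Tame.

Section RegularBigraph.
Variables (R : realType) (S1 S2 : finType).
Implicit Types (E : {set S1 * S2}) (U : {set S1}) (W : {set S2}).

Lemma density_weight E U W :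
  density R E U W =
  weight (fun x y => ((x, y) \in E)%:R) U W / (#|U|%:R * #|W|%:R).
Proof.
rewrite /density weight_setX; congr (_ / _).
rewrite -sum1_card natr_sum [RHS]big_mkcond [LHS]big_mkcond; apply: eq_bigr => -[x y] _.
by rewrite inE andbC; case: (_ \in setX _ _) => //=; case: (_ \in E).
Qed.

(** For density 0 the one-sided bound is trivial. Otherwise eta <= d and |A||B| >= delta^2 |U||W|
    make the additive error eps |U||W| at most d |A||B| / 2. *)
Lemma regular_tame (delta eps eta : R) E U W :
  0 < delta -> 0 < eta -> 2 * eps <= delta ^+ 2 * eta ->
  tame eps eta (fun x y => ((x, y) \in E)%:R) U W ->
  regular_bigraph delta U W E.
Proof.
move=> del0 eta0 heps [d [dE /uniformP u d01 d0 _]] A B sA sB hA hB.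
rewrite !density_weight dE.
set x : R := #|U|%:R; set y : R := #|W|%:R; set a : R := #|A|%:R; set b : R := #|B|%:R.
have [x0 y0 a0 b0] : [/\ 0 <= x, 0 <= y, 0 <= a & 0 <= b] by split; rewrite ler0n.
have w0 : 0 <= weight (fun x y => ((x, y) \in E)%:R) A B :> R.
  by apply: sumr_ge0 => i _; apply: sumr_ge0 => j _; rewrite ler0n.
(* An empty side has density 0, since division by 0 yields 0. *)
have [xy0|xy0] := eqVneq (x * y) 0.
  by rewrite xy0 mulr0 !mul0r divr_ge0 // mulr_ge0.
rewrite mulfK //; case: d0 => [-> | d0].
  by rewrite mul0r divr_ge0 // mulr_ge0.
have xyp : 0 < x * y by rewrite lt0r xy0 mulr_ge0.
have ab : delta ^+ 2 * (x * y) <= a * b.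
  rewrite expr2 mulrACA; apply: ler_pM; rewrite ?mulr_ge0 //; exact: ltW.
have abp : 0 < a * b by apply: lt_le_trans ab; rewrite mulr_gt0 ?exprn_gt0.
rewrite ler_pdivlMr //.
have := u _ _ sA sB; rewrite ler_norml => /andP[+ _].
rewrite -/x -/y -/a -/b.
have h1 := ler_wpM2r (ltW xyp) heps.
have h2 := ler_wpM2l (ltW eta0) ab.
have h3 := ler_wpM2r (ltW abp) d0.
lra.
Qed.

Lemma regular_no_edges (delta : R) E U W :
  (forall x y, x \in U -> y \in W -> (x, y) \notin E) ->
  regular_bigraph delta U W E.
Proof.
move=> h A B _ _ _ _; rewrite !density_weight.
rewrite (@eq_weight _ _ _ _ (fun _ _ => 0) U); last first.
  by move=> x y hx hy; rewrite (negPf (h _ _ hx hy)).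
rewrite weight_const !mul0r divr_ge0 ?mulr_ge0 //.
by apply: sumr_ge0 => i _; apply: sumr_ge0 => j _; rewrite ler0n.
Qed.

End RegularBigraph.

Lemma regular_swap (R : realType) (S1 S2 : finType) (delta : R)
    (E : {set S1 * S2}) (U : {set S1}) (W : {set S2}) :
  regular_bigraph delta U W E ->
  regular_bigraph delta W U [set p | (p.2, p.1) \in E].
Proof.
have dsw (A : {set S1}) (B : {set S2}) : density R [set p | (p.2, p.1) \in E] B A = density R E A B.
  rewrite !density_weight (mulrC #|B|%:R); congr (_ / _).
  rewrite /weight exchange_big /=; apply: eq_bigr => x _; apply: eq_bigr => y _.
  by rewrite inE.
by move=> reg B A sB sA hB hA; rewrite !dsw; apply: reg.
Qed.

Lemma sub_imset_ex (S S' : finType) (f : S -> S') (A' : {set S'}) (A : {set S}) :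
  A' \subset f @: A -> exists2 B : {set S}, B \subset A & A' = f @: B.
Proof.
move=> /subsetP sA; exists (A :&: f @^-1: A'); first exact: subsetIl.
apply/setP => y; apply/idP/imsetP => [yA|[x]]; last first.
  by rewrite !inE => /andP[_ +] ->.
by have /imsetP[x xA ey] := sA _ yA; exists x; rewrite // !inE xA -ey.
Qed.

(** Carries regularity along [inl] and [inr] into the vertex type of the link graph; [E'] need only
    agree with [E] over the two parts. *)
Lemma regular_imset (R : realType) (S1 S2 S1' S2' : finType)
    (f1 : S1 -> S1') (f2 : S2 -> S2') (delta : R) (E : {set S1 * S2})
    (E' : {set S1' * S2'}) (U : {set S1}) (W : {set S2}) :
  injective f1 -> injective f2 ->
  (forall x y, x \in U -> y \in W -> ((f1 x, f2 y) \in E') = ((x, y) \in E)) ->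
  regular_bigraph delta U W E ->
  regular_bigraph delta (f1 @: U) (f2 @: W) E'.
Proof.
move=> i1 i2 hE reg.
have dE (A : {set S1}) (B : {set S2}) : A \subset U -> B \subset W ->
    density R E' (f1 @: A) (f2 @: B) = density R E A B.
  move=> sA sB; rewrite !density_weight !card_imset //; congr (_ / _).
  rewrite /weight big_imset /=; last by move=> ? ? _ _; apply: i1.
  apply: eq_bigr => x hx; rewrite big_imset /=; last by move=> ? ? _ _; apply: i2.
  by apply: eq_bigr => y hy; rewrite hE ?(subsetP sA) ?(subsetP sB).
move=> A' B' /sub_imset_ex[A sA ->] /sub_imset_ex[B sB ->].
rewrite !card_imset // => hA hB; rewrite !dE //; exact: reg.
Qed.

(** * Counting cherries *)

Section Cherries.
Variables (R : realFieldType) (T : finType) (a : rel T).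
Let w x y : R := (a x y)%:R.
Implicit Types (A X Y Z : {set T}) (Q : {set T * T}).

(** A path of length two with centre [x]; it closes to a triangle when the pair [p] is itself an
    edge. *)
Definition cherry (x : T) (p : T * T) : R := (a x p.1 && a x p.2)%:R.

Let row Q y := [set z | (y, z) \in Q].
Let column Q z := [set y | (y, z) \in Q].

Lemma sum_rows Y Z Q (F : T * T -> R) : Q \subset setX Y Z ->
  \sum_(p in Q) F p = \sum_(y in Y) \sum_(z in row Q y) F (y, z).
Proof.
move=> sQ; rewrite pair_big_dep /=; apply: eq_big => [[y z]|[y z]] //=.
rewrite inE; case: (boolP (_ \in Q)) => [|_]; last by rewrite andbF.
by move/(subsetP sQ); rewrite in_setX => /andP[->].
Qed.

Lemma sum_columns Y Z Q (F : T * T -> R) : Q \subset setX Y Z ->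
  \sum_(p in Q) F p = \sum_(z in Z) \sum_(y in column Q z) F (y, z).
Proof.
move=> sQ; rewrite (sum_rows _ sQ) (exchange_big_dep (mem Z)) /=.
  apply: eq_bigr => z zZ; apply: eq_bigl => y; rewrite !inE.
  case: (boolP (_ \in Q)) => [|_]; last by rewrite andbF.
  by move/(subsetP sQ); rewrite in_setX => /andP[->].
move=> y z _; rewrite inE => /(subsetP sQ).
by rewrite in_setX => /andP[].
Qed.

(* Two uses of uniformity suffice although Q is arbitrary: slice Q by y and
   apply that of (X, Z) to A :&: N(y) and the row of y, then slice by z. *)
Lemma cherry_count (eps al be : R) X Y Z A Q :
  uniform eps al w X Y -> uniform eps be w X Z -> 0 <= be <= 1 ->
  0 <= eps -> A \subset X -> Q \subset setX Y Z ->
  `|weight cherry A Q - al * be * (#|A|%:R * #|Q|%:R)|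
    <= 2 * eps * (#|X|%:R * #|Y|%:R * #|Z|%:R).
Proof.
move=> /uniformP uXY /uniformP uXZ be01 eps0 sA sQ.
pose N y := [set x in A | a x y].
have rowZ y : row Q y \subset Z.
  apply/subsetP => z; rewrite inE => /(subsetP sQ).
  by rewrite in_setX => /andP[].
have colY z : column Q z \subset Y.
  apply/subsetP => y; rewrite inE => /(subsetP sQ).
  by rewrite in_setX => /andP[].
have NX y : N y \subset X.
  by apply: subset_trans sA; apply/subsetP => x; rewrite inE => /andP[].
pose M := \sum_(y in Y) (#|N y|%:R * #|row Q y|%:R : R).
have step1 : weight cherry A Q = \sum_(y in Y) weight w (N y) (row Q y).
  rewrite /weight; under eq_bigr do rewrite (sum_rows _ sQ).
  rewrite exchange_big /=; apply: eq_bigr => y _.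
  rewrite [LHS](bigID (fun x => a x y)) /= [X in _ + X]big1 ?addr0; last first.
    by move=> x /andP[_ /negPf nax]; rewrite big1 // => z _; rewrite /cherry /= nax.
  apply: eq_big => [x|x /andP[_ ax]]; first by rewrite inE.
  by apply: eq_bigr => z _; rewrite /cherry /= ax.
have step2 : `|weight cherry A Q - be * M| <= eps * (#|X|%:R * #|Y|%:R * #|Z|%:R).
  rewrite step1 /M mulr_sumr -sumrB; apply: le_trans (ler_norm_sum _ _ _) _.
  rewrite (_ : eps * _ = \sum_(y in Y) eps * (#|X|%:R * #|Z|%:R)); last first.
    by rewrite sumr_const -[RHS]mulr_natr; ring.
  by apply: ler_sum => y _; apply: uXZ.
(* [M] counts the triples with x in A adjacent to y and (y, z) in Q; grouped by z, they are the
   edges between A and a column. *)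
have step3 : M = \sum_(z in Z) weight w A (column Q z).
  have -> : M = \sum_(p in Q) #|N p.1|%:R.
    rewrite (sum_rows _ sQ); apply: eq_bigr => y _ /=.
    by rewrite sumr_const mulr_natr.
  rewrite (sum_columns _ sQ); apply: eq_bigr => z _ /=.
  rewrite /weight exchange_big /=; apply: eq_bigr => y _.
  rewrite -sum1_card natr_sum big_mkcond [RHS]big_mkcond; apply: eq_bigr => x _.
  by rewrite inE /w; case: (x \in A) => //=; case: (a x y).
have step4 : `|M - al * (#|A|%:R * #|Q|%:R)| <= eps * (#|X|%:R * #|Y|%:R * #|Z|%:R).
  have -> : #|Q|%:R = \sum_(z in Z) #|column Q z|%:R :> R.
    rewrite -sum1_card natr_sum (sum_columns _ sQ); apply: eq_bigr => z _.
    by rewrite -sum1_card natr_sum.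
  rewrite step3 mulr_sumr mulr_sumr -sumrB; apply: le_trans (ler_norm_sum _ _ _) _.
  rewrite (_ : eps * _ = \sum_(z in Z) eps * (#|X|%:R * #|Y|%:R)); last first.
    by rewrite sumr_const -[RHS]mulr_natr; ring.
  by apply: ler_sum => z _; apply: uXY.
rewrite (_ : weight _ _ _ - _ = (weight cherry A Q - be * M)
  + be * (M - al * (#|A|%:R * #|Q|%:R))); last by ring.
apply: le_trans (ler_normD _ _) _.
rewrite normrM ger0_norm; last by case/andP: be01.
have : be * `|M - al * (#|A|%:R * #|Q|%:R)| <= 1 * `|M - al * (#|A|%:R * #|Q|%:R)|.
  by rewrite ler_wpM2r //; case/andP: be01.
lra.
Qed.

End Cherries.

(** The third edge is supplied by membership in P, so only cherries are counted. Both densities lie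
    within 2 kappa of al * be on the side needed, and al * be - 2 kappa >= (al * be + 2 kappa) / 2
    holds once al * be >= eta^2 >= 6 kappa. The density of P enters through |P| >= eta |Y||Z|, which
    turns the error eps |X||Y||Z| into one relative to |X||P|. If al or be vanishes, there is no
    cherry. *)
Lemma cherry_regular (R : realType) (T : finType) (a : rel T)
    (delta eps eta kappa : R) (X Y Z : {set T}) :
  0 < delta <= 1 -> 0 < eta -> 0 <= eps ->
  eps <= kappa * (delta ^+ 2 * eta) -> 6 * kappa <= eta ^+ 2 ->
  let w := fun x y => (a x y)%:R in
  tame eps eta w X Y -> tame eps eta w X Z -> tame eps eta w Y Z ->
  regular_bigraph delta X [set p in setX Y Z | a p.1 p.2]
    [set q | a q.1 q.2.1 && a q.1 q.2.2].
Proof.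
move=> /andP[del0 del1] eta0 eps0 heps hkap w.
move=> [al [alE uXY al01 al0 _]] [be [beE uXZ be01 be0 _]] [ga [gaE _ ga01 ga0 _]].
set P := [set p in _ | _]; have sP : P \subset setX Y Z.
  by apply/subsetP => p; rewrite inE => /andP[].
have PE : #|P|%:R = ga * (#|Y|%:R * #|Z|%:R) :> R.
  rewrite -gaE weight_setX -sum1_card natr_sum big_mkcond [RHS]big_mkcond.
  by apply: eq_bigr => p _; rewrite /P inE /w; case: (p \in setX Y Z) => //=; case: (a _ _).
have zero D (L : {set T}) : weight w X L = 0 -> forall x y, x \in X -> y \in L -> a x y = D -> D = false.
  rewrite weight_setX => /eqP; rewrite psumr_eq0 => [/allP h|p _]; last by rewrite ler0n.
  move=> x y xX yL <-; apply/negbTE/negP => axy.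
  have := h (x, y) (mem_index_enum _); rewrite in_setX xX yL /w /= axy /=.
  by rewrite oner_eq0.
case: al0 => [al0|al0].
  apply: regular_no_edges => x [y z] xX; rewrite !inE /= => /andP[/andP[yY _] _].
  by rewrite (zero _ Y _ x y xX yY erefl) // alE al0 mul0r.
case: be0 => [be0|be0].
  apply: regular_no_edges => x [y z] xX; rewrite !inE /= => /andP[/andP[_ zZ] _].
  by rewrite (zero _ Z _ x z xX zZ erefl) ?andbF // beE be0 mul0r.
move=> A Q sA sQ hA hQ.
have wE B U : weight (fun x y => ((x, y) \in [set q | a q.1 q.2.1 && a q.1 q.2.2])%:R) B U
            = weight (cherry R a) B U.
  by apply: eq_weight => x p _ _; rewrite inE.
rewrite !density_weight !wE.
have w0 : 0 <= weight (cherry R a) A Q.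
  by apply: sumr_ge0 => i _; apply: sumr_ge0 => j _; rewrite ler0n.
have := cherry_count uXY uXZ be01 eps0 sA (subset_trans sQ sP).
have := cherry_count uXY uXZ be01 eps0 (subxx X) sP.
rewrite !ler_norml => /andP[_ up] /andP[low _].
move: up low w0 hA hQ.
set L := weight _ _ _; set M := weight _ _ _.
move: PE; set p : R := #|P|%:R; set q : R := #|Q|%:R; set n : R := #|A|%:R.
set x : R := #|X|%:R; set y : R := #|Y|%:R; set z : R := #|Z|%:R.
have [x0 y0 z0 n0 q0] : [/\ 0 <= x, 0 <= y, 0 <= z, 0 <= n & 0 <= q] by split; rewrite ler0n.
have p0 : 0 <= p by rewrite ler0n.
move=> PE up low w0 hA hQ.
have [xp0|xp0] := eqVneq (x * p) 0.
  by rewrite xp0 invr0 mulr0 mul0r divr_ge0 // mulr_ge0.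
have xpp : 0 < x * p by rewrite lt0r xp0 mulr_ge0.
have nq : delta ^+ 2 * (x * p) <= n * q.
  by rewrite expr2 mulrACA; apply: ler_pM; rewrite ?mulr_ge0 // ltW.
have nqp : 0 < n * q by apply: lt_le_trans nq; rewrite mulr_gt0 ?exprn_gt0.
have kap0 : 0 <= kappa.
  have : 0 <= kappa * (delta ^+ 2 * eta) by apply: le_trans heps.
  by rewrite pmulr_lge0 // mulr_gt0 ?exprn_gt0.
case: ga0 => [ga0|ga0]; first by move: xp0; rewrite PE ga0 mul0r mulr0 eqxx.
have err1 : eps * (x * y * z) <= kappa * (delta ^+ 2 * (x * p)).
  apply: (@le_trans _ _ (kappa * (delta ^+ 2 * eta) * (x * y * z))).
    by rewrite ler_wpM2r // !mulr_ge0.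
  rewrite -mulrA ler_wpM2l // -mulrA ler_wpM2l ?sqr_ge0 // PE.
  have -> : eta * (x * y * z) = eta * (x * (y * z)) by ring.
  have -> : x * (ga * (y * z)) = ga * (x * (y * z)) by ring.
  by rewrite ler_wpM2r // !mulr_ge0.
have err2 : eps * (x * y * z) <= kappa * (n * q).
  by apply: le_trans err1 _; rewrite ler_wpM2l.
have err3 : eps * (x * y * z) <= kappa * (x * p).
  apply: le_trans err1 _; rewrite ler_wpM2l // -[leRHS]mul1r ler_wpM2r ?(ltW xpp) //.
  by rewrite expr_le1 // ltW.
have ab : eta ^+ 2 <= al * be by rewrite expr2; apply: ler_pM => //; apply: ltW.
have h1 : L / (x * p) <= al * be + 2 * kappa.
  by rewrite ler_pdivrMr //; lra.
have h2 : al * be - 2 * kappa <= M / (n * q).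
  by rewrite ler_pdivlMr //; lra.
lra.
Qed.

(** * Emptying and filling bad pairs *)

Section Tidy.
Variables (R : realFieldType) (T C : finType) (c : T -> C) (a : rel T) (eps eta : R).
Let w x y : R := (a x y)%:R.
Let d := col_density c w.

Definition tidy (x y : T) : bool :=
  uniform_at c w eps (x, y) &&
  ((1 - eta < d (x, y)) || (eta <= d (x, y)) && a x y).

Lemma col_density_bounds p : 0 <= d p <= 1.
Proof. by apply: avg_bounds => q; rewrite ler0n lern1 leq_b1. Qed.

(** On a product of two classes [tidy] is constant, or it equals [a] and the pair is uniform with
    eta <= d <= 1 - eta. *)
Lemma tidy_tame x y : 0 <= eps -> eta <= 1 ->
  tame eps eta (fun x y => (tidy x y)%:R) (col_class c (c x)) (col_class c (c y)).
Proof.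
move=> eps0 eta1.
have fib x' y' : x' \in col_class c (c x) -> y' \in col_class c (c y) ->
    tidy x' y' = uniform_at c w eps (x, y) &&
      ((1 - eta < d (x, y)) || (eta <= d (x, y)) && a x' y').
  rewrite !inE => /eqP ex /eqP ey.
  have de : d (x', y') = d (x, y) by apply: avg_fiber; rewrite /pair_col /= ex ey.
  by rewrite /tidy /uniform_at /= -/d de ex ey.
have cst b : (forall x' y', x' \in col_class c (c x) -> y' \in col_class c (c y) ->
    tidy x' y' = b) ->
  tame eps eta (fun x y => (tidy x y)%:R) (col_class c (c x)) (col_class c (c y)).
  move=> h; apply: eq_tame (tame_const b _ _ eps0 eta1) => x' y' hx hy.
  by rewrite h.
have [u|nu] := boolP (uniform_at c w eps (x, y)); last first.
  by apply: (cst false) => x' y' hx hy; rewrite fib // (negPf nu).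
have [dn|dn] := ltP (1 - eta) (d (x, y)).
  by apply: (cst true) => x' y' hx hy; rewrite fib // u dn.
have [dp|dp] := lerP eta (d (x, y)); last first.
  by apply: (cst false) => x' y' hx hy; rewrite fib // u ltNge dn leNgt dp.
apply: (@eq_tame _ _ _ _ _ w) => [x' y' hx hy|].
  by rewrite fib // u ltNge dn dp.
exists (d (x, y)); split=> //; last 2 first.
- by right.
- by right.
- exact: (col_density_card c w (x, y)).
- exact: col_density_bounds.
Qed.

(** Sparseness and density depend only on the classes, so [sum_avg] replaces [w] by its density: a
    sparse pair loses, and a very dense pair gains, at most a proportion eta of its product. As eta
    <= 1/2, no pair is both. *)
Lemma tidy_close (S : {set T}) : 0 <= eta <= 2^-1 ->
  (forall x y, c x = c y -> (x \in S) = (y \in S)) ->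
  #|[set p in setX S S | tidy p.1 p.2 != a p.1 p.2]|%:R
    <= #|[pred p | ~~ uniform_at c w eps p]|%:R + eta * #|S|%:R ^+ 2.
Proof.
move=> /andP[eta0 eta2] Ssat.
pose g p : R := ((p \in setX S S) && (d p < eta))%:R.
pose h p : R := ((p \in setX S S) && (1 - eta < d p))%:R.
pose w2 (p : T * T) := w p.1 p.2.
have dfib p q : pair_col c p = pair_col c q -> d p = d q by apply: avg_fiber.
have Sfib p q : pair_col c p = pair_col c q -> (p \in setX S S) = (q \in setX S S).
  case: p q => [x y] [x' y'] [ex ey].
  by rewrite !in_setX (Ssat _ _ ex) (Ssat _ _ ey).
have gE : \sum_p w2 p * g p = \sum_p d p * g p.
  by rewrite -(@sum_avg _ _ _ (pair_col c)) // => p q e; rewrite /g (dfib _ _ e) (Sfib _ _ e).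
have hE : \sum_p w2 p * h p = \sum_p d p * h p.
  by rewrite -(@sum_avg _ _ _ (pair_col c)) // => p q e; rewrite /h (dfib _ _ e) (Sfib _ _ e).
have cardE (K : pred (T * T)) : #|K|%:R = \sum_p (K p)%:R :> R.
  by rewrite -sum1_card natr_sum big_mkcond; apply: eq_bigr => p _; rewrite unfold_in; case: (K p).
have -> : #|S|%:R ^+ 2 = \sum_p (p \in setX S S)%:R :> R.
  rewrite expr2 -natrM -cardsX -sum1_card natr_sum big_mkcond.
  by apply: eq_bigr => p _; case: (p \in _).
rewrite (_ : #|[set _ in _ | _]|%:R =
    \sum_p ((p \in setX S S) && (tidy p.1 p.2 != a p.1 p.2))%:R); last first.
  rewrite -sum1_card natr_sum big_mkcond; apply: eq_bigr => p _.
  by rewrite !inE; case: ifP.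
rewrite !cardE /= mulr_sumr.
(* A changed pair is irregular, or an edge deleted from a sparse pair of classes, or a non-edge
   filled in a dense one; the three summands count these. *)
apply: (@le_trans _ _ (\sum_p ((~~ uniform_at c w eps p)%:R + w2 p * g p + (h p - w2 p * h p)))).
  apply: ler_sum => -[x y] _; rewrite /g /h /w2 /w /=.
  case: ((x, y) \in setX S S) => /=; last by rewrite !mulr0 !addr0 subrr addr0 ler0n.
  rewrite /tidy (ltNge (d (x, y)) eta); case: (uniform_at _ _ _ _) => /=; last first.
    by case: (a x y); case: (eta <= _); case: (1 - eta < _); rewrite /=; lra.
  by case: (a x y); case: (eta <= _); case: (1 - eta < _); rewrite /=; lra.
rewrite !big_split /= sumrN gE hE -sumrN -!big_split /=.
apply: ler_sum => p _; rewrite /g /h.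
have /andP[d0 d1] := col_density_bounds p.
case: (p \in setX S S) => /=; last by rewrite !mulr0 subrr !addr0.
have [lt1|ge1] := ltP (d p) eta; have [lt2|ge2] := ltP (1 - eta) (d p); rewrite /=; lra.
Qed.

End Tidy.

(** * Link graphs of the triangle hypergraph *)

Lemma adj_sym (S : finType) (G : graph S) x y : adj G x y = adj G y x.
Proof. by rewrite /adj setUC. Qed.

Lemma adj_vertices (S : finType) (G : graph S) x y :
  adj G x y -> (x \in vertices G) && (y \in vertices G).
Proof.
by move=> /(@graphP _ G)[/subsetP h _]; rewrite !h // !inE eqxx ?orbT.
Qed.

Lemma ord3_distinct (i j k : 'I_3) :
  [set i; j; k] = [set: 'I_3] -> [/\ i != j, i != k & j != k].
Proof.
move=> e; have c3 : #|[set i; j; k]| = 3 by rewrite e cardsT card_ord.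
split; apply/negP => /eqP eij; move: c3; rewrite eij.
- by rewrite setUid cards2; case: eqVneq.
- by rewrite setUAC setUid cards2; case: eqVneq.
- by rewrite -setUA setUid cards2; case: eqVneq.
Qed.

Lemma partition_intro (S : finType) (Q : {set {set S}}) (D : {set S}) :
  (forall A, A \in Q -> A \subset D) ->
  (forall A, A \in Q -> A != set0) ->
  (forall x, x \in D -> exists2 A, A \in Q & x \in A) ->
  (forall A B x, A \in Q -> B \in Q -> x \in A -> x \in B -> A = B) ->
  partition Q D.
Proof.
move=> sub ne cov inj; apply/and3P; split.
- apply/eqP/setP => x; apply/bigcupP/idP => [[A /sub/subsetP]|/cov//]; exact.
- apply/trivIsetP => A B hA hB; apply: contraR => /pred0Pn[x /andP[/= xA xB]].
  by apply/eqP; apply: inj xA xB.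
- by apply/negP => /ne; rewrite eqxx.
Qed.

Section Triangles.
Variables (T : finType) (V : 'I_3 -> {set T}) (G : graph T).
Hypothesis Vdisj : forall i j, i != j -> [disjoint V i & V j].

Lemma class_uniq i j x : x \in V i -> x \in V j -> i = j.
Proof.
move=> xi xj; apply/eqP; apply: contraT => /Vdisj/pred0P/(_ x) /=.
by rewrite xi xj.
Qed.

Lemma class_neq i j x y : i != j -> x \in V i -> y \in V j -> x != y.
Proof. by move=> ij xi yj; apply: contraNneq ij => e; apply/eqP/(@class_uniq _ _ x); rewrite // e. Qed.

(** Hyperedges are unordered, while [K3] lists the classes in a fixed order; being a clique does not
    depend on the listing, and disjointness of the classes recovers it. *)
Lemma mem_triangle_edges i1 i2 i3 u v w :
  [set i1; i2; i3] = [set: 'I_3] ->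
  u \in V i1 -> v \in V i2 -> w \in V i3 ->
  ([set u; v; w] \in triangle_edges V G) = [&& adj G u v, adj G u w & adj G v w].
Proof.
move=> e ui vi wi; have [n12 n13 n23] := ord3_distinct e.
have nuv := class_neq n12 ui vi; have nuw := class_neq n13 ui wi.
have nvw := class_neq n23 vi wi.
apply/imsetP/idP => [[[[x y] z]]|/and3P[auv auw avw]].
  rewrite inE /= => /and5P[_ _ _ axy /andP[axz ayz]] es.
  have clique p q : p \in [set u; v; w] -> q \in [set u; v; w] -> p != q -> adj G p q.
    rewrite es !inE -!orbA => /or3P[] /eqP-> /or3P[] /eqP->; rewrite ?eqxx //.
    - by rewrite adj_sym.
    - by rewrite adj_sym.
    - by rewrite adj_sym.
  by rewrite !clique // !inE eqxx ?orbT.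
have clique p q : p \in [set u; v; w] -> q \in [set u; v; w] -> p != q -> adj G p q.
  rewrite !inE -!orbA => /or3P[] /eqP-> /or3P[] /eqP->; rewrite ?eqxx //.
  - by rewrite adj_sym.
  - by rewrite adj_sym.
  - by rewrite adj_sym.
have rep i : exists2 p, p \in V i & p \in [set u; v; w].
  have : i \in [set i1; i2; i3] by rewrite e inE.
  rewrite !inE -orbA => /or3P[] /eqP->.
  - by exists u; rewrite // !inE eqxx.
  - by exists v; rewrite // !inE eqxx orbT.
  - by exists w; rewrite // !inE eqxx orbT.
have [x xV xs] := rep (inord 0); have [y yV ys] := rep (inord 1).
have [z zV zs] := rep (inord 2).
have n01 : inord 0 != inord 1 :> 'I_3 by rewrite -val_eqE /= !inordK.
have n02 : inord 0 != inord 2 :> 'I_3 by rewrite -val_eqE /= !inordK.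
have n12' : inord 1 != inord 2 :> 'I_3 by rewrite -val_eqE /= !inordK.
have nxy := class_neq n01 xV yV; have nxz := class_neq n02 xV zV.
have nyz := class_neq n12' yV zV.
exists (x, y, z); first by rewrite inE /= xV yV zV !clique.
apply/esym/eqP; rewrite eqEcard; apply/andP; split.
  by rewrite /= !subUset !sub1set xs ys zs.
have card3 p q r : p != q -> p != r -> q != r -> #|[set p; q; r]| = 3.
  by move=> npq npr nqr; rewrite setUC cardsU1 cards2 npq !inE negb_or eq_sym npr eq_sym nqr.
by rewrite /= !card3.
Qed.

(** Edges of the link as ordered data, for any relation: it serves both [adj G] and its tidied
    version, whose symmetry is never established. *)
Definition link_pairs i1 i2 i3 (b : rel T) : {set T * (T * T)} :=
  [set q in setX (V i1) (setX (V i2) (V i3)) |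
    [&& b q.1 q.2.1, b q.1 q.2.2 & b q.2.1 q.2.2]].

Definition link_edge (q : T * (T * T)) : {set T + T * T} := [set inl q.1; inr q.2].

Lemma link_edge_inj : injective link_edge.
Proof.
move=> [u p] [u' p'] /setP e.
have := e (inl u); have := e (inr p); rewrite !inE eqxx /= => /esym/eqP[->].
by rewrite eqxx => /esym/orP[/eqP[->]|].
Qed.

Lemma link_edgesE i1 i2 i3 : [set i1; i2; i3] = [set: 'I_3] ->
  link_edges V (triangle_edges V G) i1 i2 i3 =
  link_edge @: link_pairs i1 i2 i3 (adj G).
Proof.
move=> e; rewrite /link_edges; apply: (congr1 (fun D : {set _} => link_edge @: D)).
apply/setP => -[u [v w]].
rewrite !inE /=; apply: andb_id2l => /and3P[uV vV wV].
exact: mem_triangle_edges e uV vV wV.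
Qed.

(** Makes the allowance delta |E| of each link at least delta |K_3(G)|. *)
Lemma card_link_edges i1 i2 i3 : [set i1; i2; i3] = [set: 'I_3] ->
  (#|K3 V G| <= #|link_edges V (triangle_edges V G) i1 i2 i3|)%N.
Proof.
move=> e; rewrite link_edgesE // (card_imset _ link_edge_inj).
have -> : #|K3 V G| = #|triangle_edges V G|.
  rewrite /triangle_edges card_in_imset // => -[[x y] z] [[x' y'] z'].
  rewrite !inE /= => /and5P[xV yV zV _ _] /and5P[xV' yV' zV' _ _] es.
  have mm i p q r s : p \in V i -> q \in V (inord 0) -> r \in V (inord 1) -> s \in V (inord 2) ->
      p \in [set q; r; s] -> p = (if i == inord 0 then q else if i == inord 1 then r else s).
    rewrite !inE -orbA => pV qV rV sV /or3P[] /eqP ep; rewrite ep in pV *.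
    - by rewrite (class_uniq pV qV) eqxx.
    - by rewrite (class_uniq pV rV) eqxx -val_eqE /= !inordK.
    - by rewrite (class_uniq pV sV) -!val_eqE /= !inordK.
  have hx := mm _ x _ _ _ xV xV' yV' zV'; have hy := mm _ y _ _ _ yV xV' yV' zV'.
  have hz := mm _ z _ _ _ zV xV' yV' zV'.
  move: hx hy hz; rewrite -es !inE !eqxx !orbT -!val_eqE /= !inordK //=.
  by move=> /(_ isT)-> /(_ isT)-> /(_ isT)->.
(* Forgetting the order maps the link pairs onto the hyperedges. *)
pose f (q : T * (T * T)) := [set q.1; q.2.1; q.2.2].
apply: (leq_trans _ (leq_imset_card f _)); apply/subset_leq_card/subsetP => s sF.
have /imsetP[[[x y] z]] := sF; rewrite inE /= => /and5P[xV yV zV _ _] es.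
have rep i : exists2 p, p \in V i & p \in s.
  have : i \in [set: 'I_3] by rewrite inE.
  have -> : [set: 'I_3] = [set inord 0; inord 1; inord 2].
    by apply/setP => -[[|[|[|//]]] h]; rewrite !inE -!val_eqE /= !inordK.
  rewrite !inE -orbA es => /or3P[] /eqP->.
  - by exists x; rewrite // !inE eqxx.
  - by exists y; rewrite // !inE eqxx orbT.
  - by exists z; rewrite // !inE eqxx orbT.
have [u uV us] := rep i1; have [v vV vs] := rep i2; have [w wV ws] := rep i3.
have [n12 n13 n23] := ord3_distinct e.
have nuv := class_neq n12 uV vV; have nuw := class_neq n13 uV wV.
have nvw := class_neq n23 vV wV.
have euvw : s = [set u; v; w].
  apply/esym/eqP; rewrite eqEcard !subUset !sub1set us vs ws /=.
  rewrite (_ : #|[set u; v; w]| = 3).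
    by rewrite es setUC cardsU1 cards2; do 2?case: (_ \in _); do 2?case: (_ == _).
  by rewrite setUC cardsU1 cards2 nuv !inE negb_or eq_sym nuw eq_sym nvw.
apply/imsetP; exists (u, (v, w)) => //.
by rewrite !inE /= uV vV wV -(mem_triangle_edges e uV vV wV) -euvw sF.
Qed.

(** A triple in exactly one of the two sets contains a changed pair in one of three positions; that
    pair and the remaining vertex determine it. *)
Lemma link_pairs_close i1 i2 i3 (b b' : rel T) (S : {set T}) n :
  (forall i, V i \subset S) -> (forall i, #|V i| = n) ->
  (#|(link_pairs i1 i2 i3 b :\: link_pairs i1 i2 i3 b') :|:
     (link_pairs i1 i2 i3 b' :\: link_pairs i1 i2 i3 b)|
   <= 3 * (#|[set p in setX S S | b p.1 p.2 != b' p.1 p.2]| * n))%N.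
Proof.
move=> VS cV; set D := [set p in _ | _].
set Q := link_pairs _ _ _ b; set Q' := link_pairs _ _ _ b'.
pose f1 (t : (T * T) * T) : T * (T * T) := (t.1.1, (t.1.2, t.2)).
pose f2 (t : (T * T) * T) : T * (T * T) := (t.1.1, (t.2, t.1.2)).
pose f3 (t : (T * T) * T) : T * (T * T) := (t.2, t.1).
have sub : (Q :\: Q') :|: (Q' :\: Q) \subset
  f1 @: setX D (V i3) :|: f2 @: setX D (V i2) :|: f3 @: setX D (V i1).
  apply/subsetP => -[u [v w]] h.
  have /and3P[uV vV wV] : [&& u \in V i1, v \in V i2 & w \in V i3].
    by move: h; rewrite !inE /= => /orP[] /andP[_ /andP[]].
  have : [|| b u v != b' u v, b u w != b' u w | b v w != b' v w].
    move: h; rewrite !inE /= uV vV wV /=.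
    by case: (b u v); case: (b u w); case: (b v w); case: (b' u v); case: (b' u w); case: (b' v w).
  have [uS vS wS] : [/\ u \in S, v \in S & w \in S].
    by split; [exact: (subsetP (VS i1))|exact: (subsetP (VS i2))|exact: (subsetP (VS i3))].
  rewrite 2!in_setU -orbA => /or3P[] hb; apply/or3P.
  - by apply: Or31; apply/imsetP; exists (u, v, w); rewrite // !inE /= uS vS hb wV.
  - by apply: Or32; apply/imsetP; exists (u, w, v); rewrite // !inE /= uS wS hb vV.
  - by apply: Or33; apply/imsetP; exists (v, w, u); rewrite // !inE /= vS wS hb uV.
apply: leq_trans (subset_leq_card sub) _.
apply: leq_trans (leq_card_setU _ _) _.
rewrite mulSn mulSn mul1n addnA; apply: leq_add; last first.
  by apply: leq_trans (leq_imset_card _ _) _; rewrite cardsX cV.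
apply: leq_trans (leq_card_setU _ _) _.
by apply: leq_add; apply: leq_trans (leq_imset_card _ _) _; rewrite cardsX cV.
Qed.

End Triangles.

Lemma partition_subset (S : finType) (Q : {set {set S}}) (D A : {set S}) :
  partition Q D -> A \in Q -> A \subset D.
Proof. by move=> h hA; rewrite -(cover_partition h); apply: bigcup_sup hA. Qed.

(** * Decompositions *)

Section Decompositions.
Variables (T : finType) (S : {set T}) (D : decomposition S).

Lemma part1_eq X Y x : X \in part1 D -> Y \in part1 D -> x \in X -> x \in Y -> X = Y.
Proof.
have /and3P[_ triv _] := part1P D => hX hY xX xY.
by rewrite -(def_pblock triv hX xX) (def_pblock triv hY xY).
Qed.

Lemma part2P P : P \in part2 D ->
  exists X Y, [/\ X \in part1 D, Y \in part1 D, P \in cell D X Y,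
                  P \subset setX X Y & P != set0].
Proof.
case/bigcupP=> X hX /bigcupP[Y hY PXY]; exists X, Y.
have hP := cellP hX hY; split=> //; first exact: partition_subset hP PXY.
by apply: contraTneq PXY => ->; case/and3P: hP.
Qed.

(** [P] is nonempty, so a product of classes containing it is the one that it came from. This turns
    the containments in [good] and [link_partition] into membership in a cell. *)
Lemma part2_sub P X Y : P \in part2 D -> X \in part1 D -> Y \in part1 D ->
  P \subset setX X Y -> P \in cell D X Y.
Proof.
move=> /part2P[X' [Y' [hX' hY' PXY /subsetP sP /set0Pn[[x y] xyP]]]] hX hY /subsetP sub.
have := sP _ xyP; have := sub _ xyP; rewrite !in_setX => /andP[xX yY] /andP[xX' yY'].
by rewrite (part1_eq hX hX' xX xX') (part1_eq hY hY' yY yY').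
Qed.

Lemma part2_eq P Q p : P \in part2 D -> Q \in part2 D -> p \in P -> p \in Q -> P = Q.
Proof.
move=> hP hQ pP pQ; have [X [Y [hX hY PXY /subsetP sP _]]] := part2P hP.
have [X' [Y' [hX' hY' QXY /subsetP sQ _]]] := part2P hQ.
case: p pP pQ => x y pP pQ.
have := sP _ pP; have := sQ _ pQ; rewrite !in_setX => /andP[xX' yY'] /andP[xX yY].
rewrite (part1_eq hX' hX xX' xX) (part1_eq hY' hY yY' yY) in QXY.
have /and3P[_ triv _] := cellP hX hY.
by rewrite -(def_pblock triv PXY pP) (def_pblock triv QXY pQ).
Qed.

End Decompositions.

Section LinkPartition.
Variables (T : finType) (V : 'I_3 -> {set T}).
Hypothesis Vdisj : forall i j, i != j -> [disjoint V i & V j].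
Variable D : decomposition (vertex_union V).
Hypothesis Dref : refines (part1 D) (classes3 V).

Lemma part1_ex i x : x \in V i ->
  exists X, [/\ X \in part1 D, x \in X & X \subset V i].
Proof.
move=> xV; have xS : x \in vertex_union V by apply/bigcupP; exists i.
have /and3P[/eqP cov _ _] := part1P D.
have : x \in cover (part1 D) by rewrite cov.
case/bigcupP => X hX xX; exists X; split=> //.
have [_ /imsetP[j _ ->] sX] := Dref hX.
by rewrite (class_uniq Vdisj xV (subsetP sX _ xX)).
Qed.

Variables i1 i2 i3 : 'I_3.

Lemma link_partition_mem A : A \in link_partition i1 i2 i3 D ->
  (exists X, [/\ X \in part1 D, X \subset V i1 & A = inl @: X]) \/
  (exists X Y P, [/\ X \in part1 D, Y \in part1 D, X \subset V i2, Y \subset V i3 &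
    [/\ P \in part2 D, P \in cell D X Y, P \subset setX X Y & A = inr @: P]]).
Proof.
rewrite in_setU => /orP[] /imsetP[].
  by move=> X; rewrite inE => /andP[hX sX] ->; left; exists X.
move=> P; rewrite inE => /andP[hP /exists_inP[X hX /exists_inP[Y hY /and3P[sP sX sY]]]] ->.
by right; exists X, Y, P; split=> //; split=> //; apply: part2_sub.
Qed.

Lemma link_partitionP F :
  partition (link_partition i1 i2 i3 D) (vertices (link_graph V F i1 i2 i3)).
Proof.
have /and3P[_ _ n0] := part1P D.
apply: partition_intro => [A|A|x|A B x].
- case/link_partition_mem => [[X [_ sX ->]]|[X [Y [P [_ _ sX sY [_ _ sP ->]]]]]].
    by apply: subset_trans (subsetUl _ _); apply: imsetS.
  apply: subset_trans (subsetUr _ _); apply: imsetS; apply: subset_trans sP _.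
  by apply: setXS.
- case/link_partition_mem => [[X [hX _ ->]]|[X [Y [P [_ _ _ _ [hP _ _ ->]]]]]].
    by rewrite imset_eq0; apply: contraNneq n0 => <-.
  by rewrite imset_eq0; have [? [? []]] := part2P hP.
- rewrite in_setU => /orP[] /imsetP[].
    move=> u uV ->; have [X [hX uX sX]] := part1_ex uV.
    by exists (inl @: X); rewrite ?imset_f // in_setU imset_f // inE hX.
  move=> [v w]; rewrite in_setX => /andP[vV wV] ->.
  have [X [hX vX sX]] := part1_ex vV; have [Y [hY wY sY]] := part1_ex wV.
  have /and3P[/eqP cov _ _] := cellP hX hY.
  have : (v, w) \in cover (cell D X Y) by rewrite cov in_setX vX.
  case/bigcupP => P PXY pP; exists (inr @: P); last exact: imset_f.
  rewrite in_setU; apply/orP; right; apply: imset_f; rewrite inE.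
  apply/andP; split; first by apply/bigcupP; exists X => //; apply/bigcupP; exists Y.
  apply/exists_inP; exists X => //; apply/exists_inP; exists Y => //.
  by rewrite sX sY (partition_subset (cellP hX hY)).
- case/link_partition_mem => [[X [hX _ ->]]|[X [Y [P [_ _ _ _ [hP _ _ ->]]]]]];
  case/link_partition_mem => [[X' [hX' _ ->]]|[X' [Y' [P' [_ _ _ _ [hP' _ _ ->]]]]]];
  case/imsetP => q hq -> /imsetP[q' hq' //] [e]; rewrite -e in hq'.
    by rewrite (part1_eq hX hX' hq hq').
  by rewrite (part2_eq hP hP' hq hq').
Qed.

End LinkPartition.

(** * The decomposition given by a vertex colouring and a relation *)

Section ColouredDecomposition.
Variables (T C : finType) (S : {set T}) (c : T -> C) (b : rel T).
Hypothesis Ssat : forall x y, c x = c y -> (x \in S) = (y \in S).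

Definition col_decomposition : decomposition S :=
  @Decomposition T S (preim_partition c S)
    (fun X Y => preim_partition (fun p => b p.1 p.2) (setX X Y))
    (preim_partitionP c S) (fun X Y _ _ => preim_partitionP _ _).

(** As [S] is a union of colour classes, restricting to [S] cuts no class, and tameness of full
    classes applies. *)
Lemma col_part1 X : X \in part1 col_decomposition ->
  exists2 x, x \in S & X = col_class c (c x).
Proof.
move=> /imsetP[x xS ->]; exists x => //; apply/setP => y.
rewrite !inE [c x == _]eq_sym; case: eqP => [/Ssat ->|]; last by rewrite andbF.
by rewrite xS.
Qed.

Lemma card_col_part1 : (#|part1 col_decomposition| <= #|C|)%N.
Proof.
apply: (leq_trans _ (leq_imset_card (col_class c) _)).
apply/subset_leq_card/subsetP => X /col_part1[x _ ->].
by apply: imset_f.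
Qed.

Lemma col_cell X Y P : P \in cell col_decomposition X Y ->
  exists v, P = [set p in setX X Y | b p.1 p.2 == v].
Proof.
move=> /imsetP[p _ ->]; exists (b p.1 p.2); apply/setP => q.
by rewrite !inE [_ == b q.1 q.2]eq_sym.
Qed.

End ColouredDecomposition.

Lemma col_good (R : realType) (T C : finType) (S : {set T}) (c : T -> C)
    (b : rel T) (delta eps eta : R) :
  (forall x y, c x = c y -> (x \in S) = (y \in S)) ->
  0 < delta -> 0 < eta -> 2 * eps <= delta ^+ 2 * eta ->
  (forall x y, tame eps eta (fun x y => (b x y)%:R)
                 (col_class c (c x)) (col_class c (c y))) ->
  good delta (col_decomposition S c b).
Proof.
move=> Ssat del0 eta0 heps tm P X Y hP hX hY sP.
have [v ->] := col_cell (part2_sub hP hX hY sP).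
have [x _ ->] := col_part1 Ssat hX; have [y _ ->] := col_part1 Ssat hY.
apply: regular_tame heps _ => //; case: v.
  apply: eq_tame (tm x y) => x' y' hx hy.
  by rewrite inE in_setX hx hy /= eqb_id.
apply: eq_tame (tame_compl (tm x y)) => x' y' hx hy.
rewrite inE in_setX hx hy /= eqbF_neg.
by case: (b x' y'); rewrite ?subrr ?subr0.
Qed.

Lemma imset_setD (S S' : finType) (f : S -> S') (A B : {set S}) :
  injective f -> f @: (A :\: B) = f @: A :\: f @: B.
Proof.
move=> inj; apply/setP => y; rewrite inE; apply/idP/idP.
  by case/imsetP => x + ->; rewrite inE !mem_imset.
by case/andP => nB /imsetP[x xA ey]; move: nB; rewrite ey !mem_imset // inE xA => ->.
Qed.

(** * Regularity of the link partitions *)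

Section LinkRegular.
Variables (R : realType) (T C : finType) (V : 'I_3 -> {set T}) (G : graph T).
Variables (c : T -> C) (b : rel T) (delta eps eta kappa : R) (i1 i2 i3 : 'I_3).
Hypothesis Vdisj : forall i j, i != j -> [disjoint V i & V j].
Hypothesis idist : [set i1; i2; i3] = [set: 'I_3].

Lemma link_pairs_graphP e : e \in @link_edge T @: link_pairs V i1 i2 i3 b ->
  e \subset link_vertices V i1 i2 i3 /\ #|e| = 2.
Proof.
case/imsetP=> -[u p]; rewrite !inE /= => /andP[/andP[uV pV] _] ->.
split; last by rewrite cards2.
apply/subsetP=> x /set2P[] ->; rewrite inE.
- by apply/orP; left; apply: imset_f.
- by apply/orP; right; apply: imset_f; rewrite inE.
Qed.

Let G' := Graph link_pairs_graphP.

Lemma adj_link_pairs u p :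
  adj G' (inl u) (inr p) = ((u, p) \in link_pairs V i1 i2 i3 b).
Proof. by rewrite /adj /= -[[set _; _]]/(link_edge (u, p)) mem_imset //; apply: link_edge_inj. Qed.

Lemma adj_link_left u u' : adj G' (inl u) (inl u') = false.
Proof.
apply/negP => /imsetP[q _ /setP/(_ (inr q.2))].
by rewrite !inE eqxx orbT.
Qed.

Lemma adj_link_right p p' : adj G' (inr p) (inr p') = false.
Proof.
apply/negP => /imsetP[q _ /setP/(_ (inl q.1))].
by rewrite !inE eqxx.
Qed.

Hypothesis Ssat : forall x y, c x = c y ->
  (x \in vertex_union V) = (y \in vertex_union V).
Hypothesis del01 : 0 < delta <= 1.
Hypothesis eta0 : 0 < eta.
Hypothesis eps0 : 0 <= eps.
Hypothesis heps : eps <= kappa * (delta ^+ 2 * eta).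
Hypothesis hkap : 6 * kappa <= eta ^+ 2.
Hypothesis tm : forall x y, tame eps eta (fun x y => (b x y)%:R)
                 (col_class c (c x)) (col_class c (c y)).
Let D := col_decomposition (vertex_union V) c b.
Hypothesis Dref : refines (part1 D) (classes3 V).
Hypothesis close :
  #|(link_pairs V i1 i2 i3 (adj G) :\: link_pairs V i1 i2 i3 b) :|:
     (link_pairs V i1 i2 i3 b :\: link_pairs V i1 i2 i3 (adj G))|%:R
  <= delta * #|K3 V G|%:R.

(** Two parts on the same side of the link span no edge, nor does a class against a cell of
    b-non-edges. Against a cell of b-edges, adjacency in [G'] is a cherry of [b], and
    [cherry_regular] applies; the reverse order of the parts follows by [regular_swap]. *)
Lemma link_regular :
  regular_partition delta (link_graph V (triangle_edges V G) i1 i2 i3)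
    (link_partition i1 i2 i3 D).
Proof.
have [del0 _] := andP del01.
split; first exact: link_partitionP.
exists G'; split=> //.
  rewrite /= link_edgesE //.
  set Q := link_pairs _ _ _ _ (adj G); set Q' := link_pairs _ _ _ _ b.
  have -> : @link_edge T @: Q :\: @link_edge T @: Q' :|: (@link_edge T @: Q' :\: @link_edge T @: Q)
      = @link_edge T @: ((Q :\: Q') :|: (Q' :\: Q)).
    by rewrite imsetU !imset_setD //; apply: link_edge_inj.
  rewrite (card_imset _ (@link_edge_inj T)); apply: le_trans close _.
  by rewrite ler_wpM2l ?(ltW del0) // ler_nat -link_edgesE // card_link_edges.
have key X Y Z P : X \in part1 D -> Y \in part1 D -> Z \in part1 D ->
    X \subset V i1 -> Y \subset V i2 -> Z \subset V i3 -> P \in cell D Y Z ->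
    exists2 E : {set T * (T * T)}, regular_bigraph delta X P E &
      forall u p, u \in X -> p \in P -> adj G' (inl u) (inr p) = ((u, p) \in E).
  move=> hX hY hZ /subsetP sX /subsetP sY /subsetP sZ /col_cell[v ->].
  have mem u y z : u \in X -> (y, z) \in [set p in setX Y Z | b p.1 p.2 == v] ->
      adj G' (inl u) (inr (y, z)) = [&& b u y, b u z & v].
    move=> uX; rewrite !inE /= => /andP[/andP[yY zZ] /eqP <-].
    by rewrite adj_link_pairs !inE /= sX // sY // sZ.
  have [x _ eX] := col_part1 Ssat hX; have [y _ eY] := col_part1 Ssat hY.
  have [z _ eZ] := col_part1 Ssat hZ.
  case: v mem => mem; last first.
    exists set0; first by apply: regular_no_edges => *; rewrite inE.
    by move=> u [y' z'] uX pP; rewrite mem // !andbF inE.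
  exists [set q | b q.1 q.2.1 && b q.1 q.2.2]; last first.
    by move=> u [y' z'] uX pP; rewrite mem // inE andbT.
  rewrite (_ : [set p in _ | _] = [set p in setX Y Z | b p.1 p.2]); last first.
    by apply/setP => p; rewrite !inE eqb_id.
  by rewrite eX eY eZ; apply: cherry_regular heps hkap _ _ _.
move=> A B hA hB _.
case: (link_partition_mem hA) => [[X [hX sX ->]]|[Y [Z [P [hY hZ sY sZ [hP cP _ ->]]]]]];
case: (link_partition_mem hB) => [[X' [hX' sX' ->]]|[Y' [Z' [P' [hY' hZ' sY' sZ' [hP' cP' _ ->]]]]]].
- apply: regular_no_edges => _ _ /imsetP[u uX ->] /imsetP[u' uX' ->].
  by rewrite inE /= adj_link_left andbF.
- have [E reg hE] := key _ _ _ _ hX hY' hZ' sX sY' sZ' cP'.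
  apply: (regular_imset _ _ _ reg); [by move=> ? ? [] | by move=> ? ? [] |].
  by move=> u p uX pP; rewrite -hE // inE /= in_setX !imset_f.
- have [E reg hE] := key _ _ _ _ hX' hY hZ sX' sY sZ cP.
  apply: (regular_imset _ _ _ (regular_swap reg)); [by move=> ? ? [] | by move=> ? ? [] |].
  by move=> p u pP uX; rewrite [RHS]inE /= -hE // inE /= in_setX !imset_f //= adj_sym.
- apply: regular_no_edges => _ _ /imsetP[u uX ->] /imsetP[u' uX' ->].
  by rewrite inE /= adj_link_right andbF.
Qed.

End LinkRegular.

(** * Tower bounds and parameters *)

Lemma leq_tower_step m n : (m <= n)%N -> (m * 2 ^ m <= n * 2 ^ n)%N.
Proof. by move=> mn; rewrite leq_mul // leq_exp2l. Qed.

Lemma leq_tower_step_id m : (m <= m * 2 ^ m)%N.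
Proof. by rewrite leq_pmulr // expn_gt0. Qed.

Lemma leq_tower k m n : (m <= n)%N -> (tower k m <= tower k n)%N.
Proof.
move=> /(leq_sub2r 1); rewrite !subn1 /tower => /subnK <-.
elim: (n.-1 - m.-1)%N => //= d IH; exact: leq_trans IH (leq_tower_step_id _).
Qed.

(** If t' = t 2^t is the next value of the tower, then t 2^t 2^t = t' 2^t <= t' 2^t', two steps
    above t. *)
Lemma split_count_tower k j m : (m <= tower 3 j.+1)%N ->
  (iter k split_count m <= tower 3 (k.*2 + j).+1)%N.
Proof.
move=> mj; elim: k => [|k IH] //=.
rewrite doubleS /tower /=; move: IH; rewrite /tower /=.
set t := iter _ _ 3; move: (iter k _ m) => x xt.
apply: (@leq_trans (split_count t)).
  by rewrite /split_count !leq_mul ?leq_exp2l.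
rewrite /split_count [leqRHS]mulnC mulnC leq_mul // leq_exp2l //.
exact: leq_tower_step_id.
Qed.

(** 3^200 < 2^400 <= 2^512, and 2^9 is already below T_3(3). The extra 1 is the colour of the points
    outside all blocks. *)
Lemma leq_3_200_tower : ((3 ^ 200).+1 <= tower 3 4)%N.
Proof.
have h24 : (3 * 2 ^ 3 = 24)%N by [].
rewrite /tower /= h24.
have h9 : (2 ^ 9 <= 24 * 2 ^ 24)%N.
  by apply: (@leq_trans (2 ^ 24)%N); [rewrite leq_exp2l | rewrite leq_pmull].
apply: (@leq_trans (2 ^ (2 * 200))%N); first by rewrite expnM ltn_exp2r.
apply: leq_trans (leq_tower_step h9).
apply: (@leq_trans (2 ^ (2 ^ 9))%N); last by rewrite leq_pmull // expn_gt0.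
by rewrite leq_exp2l.
Qed.

Lemma absz_ceil_bounds (R : realType) (y : R) :
  0 <= y -> y <= (`|Num.ceil y|%N)%:R < y + 1.
Proof.
move=> y0; have := real_ceil_itv (num_real y); rewrite rmorphB /= => /andP[lo hi].
rewrite natr_absz ger0_norm ?hi /=; first by lra.
by rewrite real_ceil_ge0 ?num_real //; lra.
Qed.

(* With s = delta * rho, take eta = s^4, eps = s^16, kappa = eta^2 / 6 and
   k about s^-38 > 9 / (eps^2 * eta). *)
Lemma parameters (R : realType) (delta rho : R) :
  0 < delta < 1 / 8 -> 0 < rho < 1 ->
  exists (eps eta kappa : R) (k : nat),
    [/\ [/\ 0 <= eps, 0 < eta <= 2^-1 & 30 * eta <= delta * rho],
        [/\ eps <= kappa * (delta ^+ 2 * eta), 6 * kappa <= eta ^+ 2 &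
          2 * eps <= delta ^+ 2 * eta],
        9 < k%:R * (eps ^+ 2 * eta) &
        (k.*2 + 4 <= `|Num.ceil (delta ^- 1000 * rho ^- 1000)|)%N].
Proof.
move=> /andP[d0 d8] /andP[r0 r1]; pose s := delta * rho.
have s0 : 0 < s by rewrite mulr_gt0.
have sd : s <= delta by rewrite -[leRHS]mulr1 ler_wpM2l // ltW.
have s8 : s < 1 / 8 by apply: le_lt_trans d8.
have s2 : s ^+ 2 <= 1 / 64.
  rewrite expr2; apply: (@le_trans _ _ (1 / 8 * (1 / 8))); last by lra.
  by apply: ler_pM; apply: ltW.
have s2p : 0 < s ^+ 2 by rewrite exprn_gt0.
have s2d : s ^+ 2 <= delta ^+ 2 by rewrite !expr2; apply: ler_pM => //; apply: ltW.
have e4 : s ^+ 4 = s ^+ 2 * s ^+ 2 by rewrite -exprD.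
have s4p : 0 < s ^+ 4 by rewrite exprn_gt0.
have s4 : s ^+ 4 <= s ^+ 2 * (1 / 64) by rewrite e4 ler_wpM2l // ltW.
have s4d : 6 * s ^+ 4 <= delta ^+ 2 by lra.
have s30 : 30 * s ^+ 4 <= s.
  have -> : 30 * s ^+ 4 = (30 * s * s ^+ 2) * s by ring.
  rewrite -[leRHS]mul1r ler_wpM2r ?(ltW s0) //.
  have : s * s ^+ 2 <= 1 / 8 * (1 / 64) by apply: ler_pM => //; apply: ltW.
  lra.
pose r := s^-1; have rs : r * s = 1 by rewrite mulVf // gt_eqF.
have r8 : 8 <= r.
  by rewrite -[leRHS]mul1r ler_pdivlMr //; lra.
have r38 : 0 <= r ^+ 38 by rewrite exprn_ge0 //; lra.
have /andP[klo khi] := absz_ceil_bounds r38.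
set k := `|_|%N in klo khi.
have keps : s ^+ 16 <= s ^+ 8 / 6 * (delta ^+ 2 * s ^+ 4).
  have -> : s ^+ 8 / 6 * (delta ^+ 2 * s ^+ 4) = (s ^+ 12 / 6) * delta ^+ 2.
    by field.
  have -> : s ^+ 16 = (s ^+ 12 / 6) * (6 * s ^+ 4) by field.
  by rewrite ler_wpM2l // divr_ge0 // exprn_ge0 // ltW.
exists (s ^+ 16), (s ^+ 4), (s ^+ 8 / 6), k; split.
- split=> //; first by rewrite exprn_ge0 // ltW.
  by rewrite s4p /=; lra.
- split=> //.
    by rewrite -exprM; lra.
  have h : s ^+ 8 / 6 <= 2^-1.
    have : s ^+ 8 <= 1 by rewrite exprn_ile1 ?(ltW s0) //; lra.
    lra.
  have h2 : 0 <= delta ^+ 2 * s ^+ 4 by rewrite mulr_ge0 // ltW // exprn_gt0.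
  have := ler_wpM2r h2 h; lra.
(* eps^2 eta = s^36, so the exponent 38 leaves r^2 >= 64 > 9. *)
- have e : r ^+ 38 * (s ^+ 16 ^+ 2 * s ^+ 4) = r ^+ 2.
    have -> : r ^+ 38 = r ^+ 2 * r ^+ 36 by rewrite -exprD.
    by rewrite -(exprM s) -(exprD s) -[(16 * 2 + 4)%N]/36%N -mulrA -exprMn rs expr1n mulr1.
  apply: (@lt_le_trans _ _ (r ^+ 38 * (s ^+ 16 ^+ 2 * s ^+ 4))).
    rewrite e expr2; apply: (@lt_le_trans _ _ (8 * 8)); first by lra.
    by apply: ler_pM; lra.
  by rewrite ler_wpM2r // mulr_ge0 // exprn_ge0 // ?exprn_ge0 // ltW.
have -> : delta ^- 1000 * rho ^- 1000 = r ^+ 1000.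
  by rewrite -invfM -exprMn exprVn.
have r1000 : 0 <= r ^+ 1000 by rewrite exprn_ge0 //; lra.
have /andP[Nlo _] := absz_ceil_bounds r1000.
rewrite -(ler_nat R) natrD -muln2 natrM.
apply: le_trans _ Nlo.
have r40 : r ^+ 40 <= r ^+ 1000 by rewrite ler_weXn2l //; lra.
apply: le_trans _ r40.
(* As k < r^38 + 1, one has 2k + 4 < 2 r^38 + 6 <= 64 r^38 <= r^40. *)
have -> : r ^+ 40 = r ^+ 38 * (r * r) by rewrite -expr2 -exprD.
have rr : 64 <= r * r.
  by apply: (@le_trans _ _ (8 * 8)); [lra | apply: ler_pM; lra].
have := ler_wpM2l r38 rr.
have : 1 <= r ^+ 38 by rewrite exprn_ege1 //; lra.
lra.
Qed.

(** * The initial colouring and the assembly *)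

Lemma card_vertex_union (T : finType) (V : 'I_3 -> {set T}) n :
  (forall i, #|V i| = n) -> (#|vertex_union V| <= 3 * n)%N.
Proof.
move=> cV; rewrite /vertex_union !big_ord_recl big_ord0 setU0.
apply: leq_trans (leq_card_setU _ _) _; rewrite cV mulSn leq_add2l.
by apply: leq_trans (leq_card_setU _ _) _; rewrite !cV mulSn mul1n.
Qed.

(** [None] colours the points outside the blocks, so every refinement keeps the vertex set apart
    from the rest of [T]. *)
Definition block_col (T : finType) (Q : {set {set T}}) (x : T) : option {B | B \in Q} :=
  [pick B : {B | B \in Q} | x \in val B].

Lemma block_col_mem (T : finType) (Q : {set {set T}}) (x : T) B :
  block_col Q x = Some B -> x \in val B.
Proof. by rewrite /block_col; case: pickP => // B' xB' [<-]. Qed.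

Lemma block_col_cover (T : finType) (Q : {set {set T}}) (D : {set T}) (x : T) :
  partition Q D -> (x \in D) = isSome (block_col Q x).
Proof.
move=> /cover_partition <-; rewrite /block_col; case: pickP => [B xB|no] /=.
  by apply/bigcupP; exists (val B) => //; apply: valP.
apply/bigcupP => -[B hB xB]; have := no (exist _ B hB).
by rewrite /= xB.
Qed.

Theorem theorem6p7 (R : realType) (delta rho : R)
    (hdelta : 0 < delta < 1 / 8) (hrho : 0 < rho < 1) :
  exists n0 : nat, forall n : nat, (1 <= n)%N -> (n0 <= n)%N ->
  forall (T : finType) (V : 'I_3 -> {set T}) (G : graph T)
    (V0 : {set {set T}}),
    (forall i j, i != j -> [disjoint V i & V j]) ->
    (forall i, #|V i| = n) ->
    tripartite V G ->
    #|K3 V G|%:R =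
      rho * #|V (inord 0)|%:R * #|V (inord 1)|%:R * #|V (inord 2)|%:R ->
    partition V0 (vertex_union V) ->
    refines V0 (classes3 V) ->
    (#|V0| <= 3 ^ 200)%N ->
    exists P : decomposition (vertex_union V),
      [/\ refines (part1 P) V0,
          regular_decomposition delta (triangle_edges V G) P
        & (#|part1 P| <=
             3 ^ 200 * tower_real 3 (delta ^- 1000 * rho ^- 1000))%N].
Proof.
have [eps [eta [kappa [k [[eps0 /andP[eta0 eta2] eta30] [heps hkap heps2] hk hN]]]]] :=
  parameters hdelta hrho.
rewrite /tower_real; move: `|_|%N hN => N hN.
have M0 : (0 < 3 ^ 200)%N by rewrite expn_gt0.
(* The tower value at 4 bounds the number of initial colours, and the k rounds add 2k to the
   index. *)
have [j Mtower jN] :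
    exists2 j, ((3 ^ 200).+1 <= tower 3 j.+1)%N & (k.*2 + j.+1 <= N)%N.
  by exists 3; first exact: leq_3_200_tower.
move: M0 Mtower; move: (3 ^ 200)%N => M M0 Mtower {hN}.
have /andP[del0 del8] := hdelta; have del01 : 0 < delta <= 1 by rewrite del0; lra.
exists 0%N => n n1 _ T V G V0 Vdisj cV [vG _] cK pV0 rV0 cV0.
set S := vertex_union V; pose w x y : R := (adj G x y)%:R.
have nS : #|S|%:R <= 3 * n%:R :> R by rewrite -natrM ler_nat card_vertex_union.
have n0 : 0 < n%:R :> R by rewrite ltr0n.
have nS2 : #|S|%:R ^+ 2 <= 9 * n%:R ^+ 2 :> R.
  have := ler_pM (ler0n R _) (ler0n R _) nS nS; rewrite !expr2; lra.
have w01 x y : 0 <= w x y <= 1 by rewrite ler0n lern1 leq_b1.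
have sumw : \sum_p w p.1 p.2 < k%:R * (eps ^+ 2 * (eta * n%:R ^+ 2)).
  apply: (@le_lt_trans _ _ (#|S|%:R ^+ 2)).
    rewrite expr2 -natrM -cardsX -sum1_card natr_sum [leRHS]big_mkcond.
    apply: ler_sum => -[x y] _; rewrite /w in_setX /=.
    case: (boolP (adj G x y)) => [/adj_vertices|_]; last by case: ifP.
    by rewrite vG => ->.
  apply: (le_lt_trans nS2).
  by rewrite (mulrA (eps ^+ 2)) (mulrA k%:R) ltr_pM2r ?exprn_gt0.
have [C [c [cref cC small]]] := regularity (block_col V0) eps0 w01 sumw.
have Ssat x y : c x = c y -> (x \in S) = (y \in S).
  by move=> /cref e; rewrite !(block_col_cover _ pV0) e.
pose b := tidy c (adj G) eps eta; pose D := col_decomposition S c b.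
have eta1 : eta <= 1 by lra.
have tm x y : tame eps eta (fun x y => (b x y)%:R) (col_class c (c x)) (col_class c (c y)).
  exact: tidy_tame.
have refV0 : refines (part1 D) V0.
  move=> X /(col_part1 Ssat)[x xS ->]; have := xS; rewrite (block_col_cover _ pV0).
  case eB : (block_col V0 x) => [B|] // _; exists (val B); first exact: valP.
  apply/subsetP => y; rewrite inE => /eqP/cref; rewrite eB; exact: block_col_mem.
have ref3 : refines (part1 D) (classes3 V).
  move=> X /refV0[B /rV0[A hA BA] XB]; exists A => //; exact: subset_trans BA.
exists D; split=> //.
  split=> // [|i1 i2 i3 e _].
    exact: col_good heps2 tm.
  apply: link_regular heps hkap tm ref3 _ => //.
  have VS i : V i \subset S by apply: bigcup_sup.
  have := link_pairs_close i1 i2 i3 (adj G) b VS cV.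
  rewrite -(ler_nat R) => /le_trans; apply; rewrite cK !cV !natrM.
  have etaS : 0 <= eta <= 2^-1 by rewrite ltW.
  have := tidy_close (adj G) eps etaS Ssat.
  rewrite (_ : [set p in _ | _] = [set p in setX S S | adj G p.1 p.2 != b p.1 p.2]); last first.
    by apply/setP => p; rewrite !inE eq_sym.
  set m : R := #|_|%:R; move=> mle.
  (* 10 = 1 + 9: irregular pairs give eta n^2, and tidying gives eta |S|^2 <= 9 eta n^2. *)
  have m10 : m <= 10 * (eta * n%:R ^+ 2).
    have := ler_wpM2l (ltW eta0) nS2; move: small; rewrite -/w; lra.
  have := ler_wpM2r (ltW n0) m10.
  have := ler_wpM2r (exprn_ge0 3 (ltW n0)) eta30.
  have -> : 10 * (eta * n%:R ^+ 2) * n%:R = 10 * (eta * n%:R ^+ 3) :> R by ring.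
  have -> : delta * (rho * n%:R * n%:R * n%:R) = delta * rho * n%:R ^+ 3 :> R by ring.
  lra.
apply: leq_trans (leq_pmull _ M0); apply: leq_trans (card_col_part1 b Ssat) _.
apply: leq_trans cC _.
have c0 : (#|{: option {B | B \in V0}}| <= tower 3 j.+1)%N.
  by rewrite card_option card_sig; apply: leq_trans Mtower; rewrite ltnS.
apply: leq_trans (split_count_tower k c0) _.
by apply: leq_tower; rewrite -addnS.
Qed.
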